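(* Let $T$ be a countable complete first-order theory with monster model $\mathfrak{C}$, let $A\subseteq\mathfrak{C}$ be countable and let $\alpha$ be a countable ordinal. Suppose that: (1) $X\subseteq\mathfrak{C}^\alpha$ is type definable over $A$. (2) $E$ is a pseudo $F_\sigma$, $\emptyset$-invariant equivalence relation on $X$ with normal form $\langle U_n\mid n<\omega\rangle$, and $E$ is bounded on $X$. (3) $C\subseteq X$ is an $E$-class, and $E\upharpoonright C$ is not strongly closed with respect to $\langle U_n\mid n<\omega\rangle$, i.e. there is no $n<\omega$ with $E\cap C^2=U_n\cap C^2$. (4) $C\subseteq Y\subseteq X$, where $Y$ is pseudo $G_\delta$, $E$-invariant (a union of $E$-classes) and $\Gamma$-invariant. (5) $\Gamma\leq\operatorname{Aut}(\mathfrak{C})$ is $C$-transitive (for all $a,b\in C$ there is $\sigma\in\Gamma$ with $\sigma(a)=b$), and for every $\sigma\in\Gamma$ there is some $n<\omega$ such that $(c,\sigma(c))\in U_n$ for all $c\in C$. Then $E\upharpoonright Y$ is not smooth.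
   Context: $\mathfrak{C}$ is a monster model of $T$: $\kappa$-saturated and $\kappa$-homogeneous for a big cardinal $\kappa$. ''Small'' means of cardinality $<\kappa$; all parameter sets and models ($M\prec\mathfrak{C}$) are small. A subset of $\mathfrak{C}^\alpha$ is pseudo closed if it is type definable over some small set, pseudo open if its complement is pseudo closed, and pseudo $G_\delta$ (pseudo $F_\sigma$) if it is a countable intersection of pseudo open (countable union of pseudo closed) sets. A set is $\emptyset$-invariant if it is invariant under $\operatorname{Aut}(\mathfrak{C})$. An $\emptyset$-invariant pseudo $F_\sigma$ equivalence relation on $X$ means an $\emptyset$-invariant pseudo $F_\sigma$ set $E\subseteq\mathfrak{C}^\alpha\times\mathfrak{C}^\alpha$ whose restriction to $X$ is an equivalence relation; it is bounded if $|X/E|<\kappa$. A normal form is a sequence of $\emptyset$-type definable sets $U_n\subseteq\mathfrak{C}^\alpha\times\mathfrak{C}^\alpha$ with $E=\bigcup_{n<\omega}U_n$, such that $U_0$ contains the diagonal of $X$, each $U_n$ is symmetric, and for all $a,b,c\in X$, $(a,c),(c,b)\in U_n$ implies $(a,b)\in U_{n+1}$. For a model $M\supseteq A$ and $Z\subseteq\mathfrak{C}^\alpha$, $Z_M=\{\operatorname{tp}(a/M)\mid a\in Z\}\subseteq S_\alpha(M)$, with the topology induced from the Stone space. For $p,q\in X_M$, $p\mathrel{E^M}q$ iff there are $a\models p$, $b\models q$ in $\mathfrak{C}$ with $a\mathrel{E}b$ (equivalently, all such $a,b$ satisfy $a\mathrel{E}b$). When $M\supseteq A$ is a countable model, $S_\alpha(M)$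 is Polish, $Y_M$ is a $G_\delta$ subset of it, and $E^M\upharpoonright Y_M$ is an $F_\sigma$ equivalence relation whose Borel cardinality (class up to Borel bi-reducibility) does not depend on the choice of the countable model $M\supseteq A$. ''$E\upharpoonright Y$ is smooth'' means that $E^M\upharpoonright Y_M$ is smooth for some (equivalently every) countable model $M\supseteq A$, i.e. there is a Borel map $f:Y_M\to2^\omega$ with $p\mathrel{E^M}q\iff f(p)=f(q)$. *)

(* Defs.v *)
From HB Require Import structures.
From mathcomp Require Import all_boot all_order all_algebra.
From mathcomp Require Import all_classical all_reals all_analysis.

Set Implicit Arguments.
Unset Strict Implicit.
Unset Printing Implicit Defensive.

Local Open Scope classical_set_scope.
Local Open Scope card_scope.

Record language := Language {
  fsym : Type;
  farity : fsym -> nat;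
  rsym : Type;
  rarity : rsym -> nat
}.

Definition countable_language (L : language) :=
  countable [set: fsym L] /\ countable [set: rsym L].

Inductive term (L : language) (V : Type) : Type :=
| Var of V
| App (f : fsym L) of ('I_(farity f) -> term L V).

(* [formula L V]: formulas with free variables in [V].  A quantifier binds the
   new variable [None : option V].  A formula in the variables [V] with
   parameters from [B] is an element of [formula L (V + B)]. *)
Inductive formula (L : language) (V : Type) : Type :=
| Bot
| Eq of term L V & term L V
| Rel (r : rsym L) of ('I_(rarity r) -> term L V)
| Imp of formula L V & formula L V
| All of formula L (option V).

Arguments Bot {L V}.

Definition Neg (L : language) (V : Type) (phi : formula L V) : formula L V :=
  Imp phi Bot.

Record structure (L : language) (D : Type) := Structure {
  finterp : forall f : fsym L, ('I_(farity f) -> D) -> D;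
  rinterp : forall r : rsym L, ('I_(rarity r) -> D) -> Prop
}.

Fixpoint eval (L : language) (D : Type) (N : structure L D) (V : Type)
    (e : V -> D) (t : term L V) : D :=
  match t with
  | Var v => e v
  | App f ts => finterp N (fun i => eval N e (ts i))
  end.

Definition env_cons (D V : Type) (d : D) (e : V -> D) (v : option V) : D :=
  if v is Some w then e w else d.

Fixpoint sat (L : language) (D : Type) (N : structure L D) (V : Type)
    (phi : formula L V) : (V -> D) -> Prop :=
  match phi with
  | Bot => fun _ => False
  | Eq t u => fun e => eval N e t = eval N e u
  | Rel r ts => fun e => rinterp N (fun i => eval N e (ts i))
  | Imp phi1 phi2 => fun e => sat N phi1 e -> sat N phi2 e
  | All phi1 => fun e => forall d : D, sat N phi1 (env_cons d e)
  end.

Definition sentence (L : language) := formula L void.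

Definition models (L : language) (D : Type) (N : structure L D)
    (T : set (sentence L)) :=
  inhabited D /\ forall phi, T phi -> sat N phi (of_void D).

Definition entails (L : language) (T : set (sentence L)) (phi : sentence L) :=
  forall (D : Type) (N : structure L D), models N T -> sat N phi (of_void D).

Definition complete_theory (L : language) (T : set (sentence L)) :=
  (exists (D : Type) (N : structure L D), models N T) /\
  (forall phi, entails T phi \/ entails T (Neg phi)).

(* [M] is (the universe of) an elementary substructure. *)
Definition elementary_sub (L : language) (D : Type) (N : structure L D)
    (M : set D) :=
  exists NM : structure L M,
    forall phi : formula L M, sat NM phi id <-> sat N phi set_val.

Definition automorphism (L : language) (D : Type) (N : structure L D)
    (s : D -> D) :=
  [/\ bijective s,
      forall (f : fsym L) xs, s (finterp N (f := f) xs) = finterp N (s \o xs) &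
      forall (r : rsym L) xs, rinterp N (r := r) xs <-> rinterp N (s \o xs)].

Definition aut_subgroup (L : language) (D : Type) (N : structure L D)
    (G : set (D -> D)) :=
  [/\ G `<=` automorphism N,
      G id,
      forall s t, G s -> G t -> G (s \o t) &
      forall s, G s -> exists2 t, G t & cancel s t /\ cancel t s].

Definition with_params (D V : Type) (B : set D) (a : V -> D) (v : V + B) : D :=
  match v with inl i => a i | inr b => set_val b end.

(* Completeness and finite satisfiability give deductive closure. *)
Definition complete_types (L : language) (D : Type) (N : structure L D)
    (V : Type) (B : set D) : set (set (formula L (V + B))) :=
  [set p | (forall F, finite_set F -> F `<=` p ->
              exists a : V -> D, forall phi, F phi -> sat N phi (with_params a)) /\
           (forall phi, p phi \/ p (Neg phi))].

Arguments complete_types {L D} N V B _.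

Definition stone (L : language) (D : Type) (N : structure L D) (V : Type)
  (B : set D) : Type := complete_types N V B.

Arguments stone {L D} N V B.

Section StoneTopology.
Context (L : language) (D : Type) (N : structure L D) (V : Type) (B : set D).

HB.instance Definition _ := Choice.on (stone N V B).

Definition stone_basic (phi : formula L (V + B)) : set (stone N V B) :=
  [set p | (val p : set _) phi].

HB.instance Definition _ :=
  @isSubBaseTopological.Build (stone N V B) (set (stone N V B))
    (range stone_basic) id.
End StoneTopology.

Section TypeOf.
Context (L : language) (D : Type) (N : structure L D) (V : Type) (B : set D).

Definition tp_set (a : V -> D) : set (formula L (V + B)) :=
  [set phi | sat N phi (with_params a)].

Lemma tp_set_complete (a : V -> D) : complete_types N V B (tp_set a).
Proof.
split=> [F _ Fp|phi]; first by exists a => phi /Fp.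
by rewrite /tp_set /=; case: (EM (sat N phi (with_params a))); [left|right].
Qed.

Definition tp (a : V -> D) : stone N V B :=
  exist _ (tp_set a) (mem_set (tp_set_complete a)).
End TypeOf.

Arguments tp {L D} N {V} B a.

(* The cardinal kappa is given by a type of that cardinality. *)
Definition small (kappa T : Type) (S : set T) :=
  S #<= [set: kappa] /\ ~ ([set: kappa] #<= S).

(* The sets whose cardinality is independent of the monster (the language,
   alpha, A, and type spaces over countable sets) have size at most 2^aleph_0. *)
Definition big (kappa : Type) := small kappa [set: nat -> bool].

Definition saturated (kappa : Type) (L : language) (D : Type)
    (N : structure L D) :=
  forall B : set D, small kappa B ->
    forall p : stone N unit B, exists a : unit -> D, tp N B a = p.

Definition partial_elementary (L : language) (D : Type) (N : structure L D)
    (B : set D) (f : B -> D) :=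
  forall phi : formula L B, sat N phi set_val <-> sat N phi f.

(* Homogeneity of a monster model: small partial elementary maps extend to
   automorphisms. *)
Definition homogeneous (kappa : Type) (L : language) (D : Type)
    (N : structure L D) :=
  forall B : set D, small kappa B ->
    forall f : B -> D, partial_elementary N f ->
      exists2 s, automorphism N s & forall b : B, s (set_val b) = f b.

Definition monster (kappa : Type) (L : language) (T : set (sentence L))
    (D : Type) (N : structure L D) :=
  [/\ big kappa, models N T, saturated kappa N & homogeneous kappa N].

Definition type_definable (L : language) (D : Type) (N : structure L D)
    (V : Type) (B : set D) (Z : set (V -> D)) :=
  exists Phi : set (formula L (V + B)),
    Z = [set a | forall phi, Phi phi -> sat N phi (with_params a)].

Definition pseudo_closed (kappa : Type) (L : language) (D : Type)
    (N : structure L D) (V : Type) (Z : set (V -> D)) :=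
  exists2 B : set D, small kappa B & type_definable N B Z.

Definition pseudo_open (kappa : Type) (L : language) (D : Type)
    (N : structure L D) (V : Type) (Z : set (V -> D)) :=
  pseudo_closed kappa N (~` Z).

Definition pseudo_Gdelta (kappa : Type) (L : language) (D : Type)
    (N : structure L D) (V : Type) (Z : set (V -> D)) :=
  exists2 F : nat -> set (V -> D),
    (forall n, pseudo_open kappa N (F n)) & Z = \bigcap_n F n.

Definition pseudo_Fsigma (kappa : Type) (L : language) (D : Type)
    (N : structure L D) (V : Type) (Z : set (V -> D)) :=
  exists2 F : nat -> set (V -> D),
    (forall n, pseudo_closed kappa N (F n)) & Z = \bigcup_n F n.

Definition set_invariant (D V : Type) (G : set (D -> D)) (Z : set (V -> D)) :=
  forall s, G s -> forall a, Z a <-> Z (s \o a).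

Definition empty_invariant (L : language) (D : Type) (N : structure L D)
    (V : Type) (Z : set (V -> D)) :=
  set_invariant (automorphism N) Z.

(* D^V x D^V is identified with D^(V + V), so that the notions above apply to
   relations. *)
Definition rel_set (D V : Type) (R : set ((V -> D) * (V -> D))) :
    set (V + V -> D) :=
  [set c : V + V -> D | R (c \o inl, c \o inr)].

Definition equiv_on (S : Type) (X : set S) (E : set (S * S)) :=
  [/\ forall a, X a -> E (a, a),
      forall a b, X a -> X b -> E (a, b) -> E (b, a) &
      forall a b c, X a -> X b -> X c -> E (a, b) -> E (b, c) -> E (a, c)].

Definition class_of (S : Type) (X : set S) (E : set (S * S)) (a : S) : set S :=
  [set b | X b /\ E (a, b)].

Definition quotient_set (S : Type) (X : set S) (E : set (S * S)) :
  set (set S) := class_of X E @` X.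

Definition invariant_Fsigma_equiv (kappa : Type) (L : language) (D : Type)
    (N : structure L D) (V : Type) (X : set (V -> D))
    (E : set ((V -> D) * (V -> D))) :=
  [/\ empty_invariant N (rel_set E), pseudo_Fsigma kappa N (rel_set E) &
      equiv_on X E].

Definition bounded_equiv (kappa S : Type) (X : set S) (E : set (S * S)) :=
  small kappa (quotient_set X E).

Definition normal_form (L : language) (D : Type) (N : structure L D) (V : Type)
    (X : set (V -> D)) (E : set ((V -> D) * (V -> D)))
    (U : nat -> set ((V -> D) * (V -> D))) :=
  [/\ forall n, type_definable N set0 (rel_set (U n)),
      E = \bigcup_n U n,
      forall a, X a -> U 0%N (a, a),
      forall n a b, U n (a, b) -> U n (b, a) &
      forall n a b c, X a -> X b -> X c ->
        U n (a, c) -> U n (c, b) -> U n.+1 (a, b)].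

Definition strongly_closed_on (S : Type) (U : nat -> set (S * S))
    (E : set (S * S)) (C : set S) :=
  exists n, E `&` (C `*` C) = U n `&` (C `*` C).

(* [Y] is a union of [E]-classes of [X]. *)
Definition union_of_classes (S : Type) (X : set S) (E : set (S * S))
    (Y : set S) :=
  exists2 Q, Q `<=` quotient_set X E & Y = \bigcup_(K in Q) K.

Definition transitive_on (D V : Type) (G : set (D -> D)) (C : set (V -> D)) :=
  forall a b, C a -> C b -> exists2 s, G s & s \o a = b.

Definition borel (T : topologicalType) : set (set T) := <<s @open T >>.

Definition borel_fun (T U : topologicalType) (f : T -> U) :=
  forall B, borel B -> borel (f @^-1` B).

Definition type_space_of (L : language) (D : Type) (N : structure L D)
    (V : Type) (M : set D) (Z : set (V -> D)) : set (stone N V M) :=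
  tp N M @` Z.

Definition type_rel (L : language) (D : Type) (N : structure L D)
    (V : Type) (M : set D) (E : set ((V -> D) * (V -> D)))
    (p q : stone N V M) :=
  exists a b, [/\ tp N M a = p, tp N M b = q & E (a, b)].

Arguments type_space_of {L D} N {V} M Z _.

(* [Y_M] carries the topology induced from the Stone space. *)
Definition smooth_over (L : language) (D : Type) (N : structure L D)
    (V : Type) (M : set D) (E : set ((V -> D) * (V -> D)))
    (Y : set (V -> D)) :=
  exists2 f : type_space_of N M Y -> cantor_space, borel_fun f &
    forall p q, type_rel E (set_val p) (set_val q) <-> f p = f q.

Definition smooth_on (L : language) (D : Type) (N : structure L D)
    (V : Type) (A : set D) (E : set ((V -> D) * (V -> D)))
    (Y : set (V -> D)) :=
  exists M : set D,
    [/\ countable M, A `<=` M, elementary_sub N M & smooth_over N M E Y].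

(* An ordinal is given by a well-ordered type of that order type. *)
Record ordinal_type := OrdinalType {
  ord_car :> Type;
  ord_lt : ord_car -> ord_car -> Prop;
  ord_lt_trans : forall x y z, ord_lt x y -> ord_lt y z -> ord_lt x z;
  ord_lt_total : forall x y, [\/ ord_lt x y, x = y | ord_lt y x];
  ord_lt_wf : well_founded ord_lt
}.

(* Main.v *)
(** The argument is a Baire category argument in which "generic" means
    "outside an invariant ideal".  By compactness and boundedness, two points of
    [X] with the same type over a model are equivalent (a coheir argument), so
    [C] is totally bounded: whenever a neighbourhood [T n (k n)] of each [U n]
    is chosen, finitely many balls of finitely many of these neighbourhoods
    cover [C].  Let [J] be a maximal proper [Gamma]-invariant ideal of subsets
    of [C].  If [S] is not in [J], then finitely many translates of [S] cover
    [C] modulo [J], which gives three things for sets outside [J].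

    - Any pseudo open set containing [C] contains, up to shrinking, part of any
      such [S]; hence [Y] is comeager.
    - Since [C] is not contained in any [U n]-ball, for all [S1], [S2] and [n]
      there are smaller sets whose points in [C] are far apart in the sense of
      [U n]; hence [E] is meager.
    - For all [S1], [S2] some translate of [S1] meets [S2] outside [J]; hence
      every Borel [E]-invariant set is meager or comeager.

    A Borel reduction of [E] to equality would thus be constant on a comeager
    set, while this set contains inequivalent points. *)

Require Import Defs.
From mathcomp Require Import all_boot all_order all_algebra.
From mathcomp Require Import all_classical all_reals all_analysis.
From Stdlib Require List.

Set Implicit Arguments.
Unset Strict Implicit.
Unset Printing Implicit Defensive.

Local Open Scope classical_set_scope.

(** * Formulas *)

(** [Gamma] need not preserve any countable model, so it need not act on the type space on which the
    reduction is defined. Category is therefore developed on tuples: conditions are sets definable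
    over varying countable parameter sets and lying outside the ideal, so that translates of
    conditions are again conditions. A second obstacle is that [C] need not be type definable. A
    decreasing sequence of conditions meets [C] at every finite stage, but the limit points that
    compactness provides are only known to lie in [X]. This is why meagerness is tested on [X], why
    the complement of [Y] has to be shown meager, and why the bound on the displacement by an
    element of [Gamma], known on [C] only, must be carried to the limit as a definable relation
    between two points. To make this possible each [U n] is approximated by definable sets [T n k],
    with [n] read as a radius and [k] as a fineness. *)

Fixpoint rename_term (L : language) (V W : Type) (f : V -> W)
    (t : term L V) : term L W :=
  match t with
  | Var v => Var L (f v)
  | App g ts => App (fun i => rename_term f (ts i))
  end.

Fixpoint rename (L : language) (V W : Type) (f : V -> W)
    (phi : formula L V) : formula L W :=
  match phi with
  | Bot => Bot
  | Eq t u => Eq (rename_term f t) (rename_term f u)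
  | Rel r ts => Rel (fun i => rename_term f (ts i))
  | Imp p q => Imp (rename f p) (rename f q)
  | All p => All (rename (omap f) p)
  end.

Definition Ex (L : language) (V : Type) (phi : formula L (option V)) :
  formula L V := Neg (All (Neg phi)).

Definition And (L : language) (V : Type) (phi psi : formula L V) :
  formula L V := Neg (Imp phi (Neg psi)).

Section Satisfaction.
Context (L : language) (D : Type) (N : structure L D).

Lemma eval_rename (V W : Type) (f : V -> W) (e : W -> D) (t : term L V) :
  Defs.eval N e (rename_term f t) = Defs.eval N (e \o f) t.
Proof.
elim: t => //= g ts IH; congr (finterp _ _).
by apply: funext => i; exact: IH.
Qed.

Lemma sat_rename (V W : Type) (f : V -> W) (phi : formula L V) (e : W -> D) :
  sat N (rename f phi) e <-> sat N phi (e \o f).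
Proof.
elim: phi W f e => {V} [V|V t u|V r ts|V p IHp q IHq|V p IHp] W f e /=.
- by [].
- by rewrite !eval_rename.
- suff -> : (fun i => Defs.eval N e (rename_term f (ts i))) =
            (fun i => Defs.eval N (e \o f) (ts i)) by [].
  by apply: funext => i; rewrite eval_rename.
- by rewrite IHp IHq.
- have E d : env_cons d e \o omap f = env_cons d (e \o f).
    by apply: funext => -[].
  by split=> H d; have := H d; rewrite IHp E.
Qed.

Lemma sat_and (V : Type) (phi psi : formula L V) (e : V -> D) :
  sat N (And phi psi) e <-> sat N phi e /\ sat N psi e.
Proof.
rewrite /=; split=> [H|[Hp Hq] H]; last exact: H.
by split; apply: contrapT => n; apply: H => // Hp Hq; apply: n.
Qed.

Lemma sat_ex (V : Type) (phi : formula L (option V)) (e : V -> D) :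
  sat N (Ex phi) e <-> exists d, sat N phi (env_cons d e).
Proof.
rewrite /=; split=> [H|[d Hd] H]; last exact: H Hd.
by apply: contrapT => n; apply: H => d Hd; apply: n; exists d.
Qed.

Lemma eval_support (V : Type) (r : V -> nat) (t : term L V) :
  exists n, forall e e' : V -> D,
    (forall v, (r v < n)%N -> e v = e' v) -> Defs.eval N e t = Defs.eval N e' t.
Proof.
elim: t => [v|g ts IH]; first by exists (r v).+1 => e e' /= ->.
have [n Hn] := choice IH.
exists (\max_i n i)%N => e e' H /=; congr (finterp _ _).
apply: funext => i; apply: Hn => v lv; apply: H.
exact: leq_trans lv (leq_bigmax i).
Qed.

(** The finite set of relevant variables is recorded as a bound on a rank. The rank need not be
    injective, so under a quantifier the bound variable may simply receive rank 0. *)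
Lemma sat_support (V : Type) (r : V -> nat) (phi : formula L V) :
  exists n, forall e e' : V -> D,
    (forall v, (r v < n)%N -> e v = e' v) -> (sat N phi e <-> sat N phi e').
Proof.
elim: phi r => {V} [V|V t u|V R ts|V p IHp q IHq|V p IHp] r.
- by exists 0%N.
- have [n Hn] := eval_support r t; have [m Hm] := eval_support r u.
  exists (maxn n m) => e e' H /=; rewrite (Hn e e') ?(Hm e e') // => v lv;
    by apply: H; rewrite leq_max lv ?orbT.
- have [n Hn] := choice (fun i => eval_support r (ts i)).
  exists (\max_i n i)%N => e e' H /=.
  suff -> : (fun i => Defs.eval N e (ts i)) = (fun i => Defs.eval N e' (ts i)) by [].
  apply: funext => i; apply: Hn => v lv; apply: H.
  exact: leq_trans lv (leq_bigmax i).
- have [n Hn] := IHp r; have [m Hm] := IHq r.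
  exists (maxn n m) => e e' H /=; rewrite (Hn e e') ?(Hm e e') // => v lv;
    by apply: H; rewrite leq_max lv ?orbT.
- have [n Hn] := IHp (fun o => if o is Some v then r v else 0%N).
  exists n => e e' H /=.
  have E d : sat N p (env_cons d e) <-> sat N p (env_cons d e').
    by apply: (Hn (env_cons d e) (env_cons d e')) => -[v /H|].
  by split=> Hp d; apply/E.
Qed.

Lemma eval_automorphism (s : D -> D) (V : Type) (e : V -> D) (t : term L V) :
  automorphism N s -> s (Defs.eval N e t) = Defs.eval N (s \o e) t.
Proof.
move=> [_ sf _]; elim: t => //= g ts IH; rewrite sf; congr (finterp _ _).
by apply: funext => i; exact: IH.
Qed.

Lemma sat_automorphism (s : D -> D) (V : Type) (phi : formula L V)
    (e : V -> D) :
  automorphism N s -> (sat N phi (s \o e) <-> sat N phi e).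
Proof.
move=> sA; have [[t st ts] _ sr] := sA.
elim: phi e => {V} [V|V u v|V R us|V p IHp q IHq|V p IHp] e //=.
- by rewrite -!eval_automorphism //; split=> [/(can_inj st)|->].
- suff -> : (fun i => Defs.eval N (s \o e) (us i)) = s \o (fun i => Defs.eval N e (us i)).
    by rewrite -sr.
  by apply: funext => i; rewrite -eval_automorphism.
- by rewrite IHp IHq.
- have E d : env_cons (s d) (s \o e) = s \o env_cons d e.
    by apply: funext => -[].
  split=> H d; first by rewrite -IHp -E.
  by rewrite -(ts d) E IHp.
Qed.

End Satisfaction.

(** * Countability of the set of formulas *)

Section Countability.
Context (L : language) (cf : Defs.fsym L -> nat) (cr : rsym L -> nat).
Hypotheses (cf_inj : injective cf) (cr_inj : injective cr).

Fixpoint encode_term (V : Type) (r : V -> nat) (t : term L V) :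
    GenTree.tree nat :=
  match t with
  | Var v => GenTree.Leaf (r v)
  | App g ts =>
      GenTree.Node (cf g) [seq encode_term r (ts i) | i <- enum 'I_(farity g)]
  end.

Definition option_rank (V : Type) (r : V -> nat) (o : option V) : nat :=
  if o is Some v then (r v).+1 else 0%N.

(** Trees over [nat] form a countable type. The tags 0, 1 and 2 are taken by [Eq], [Imp] and [All],
    hence the shift by three for relation symbols. *)
Fixpoint encode (V : Type) (r : V -> nat) (phi : formula L V) :
    GenTree.tree nat :=
  match phi with
  | Bot => GenTree.Leaf 0%N
  | Eq t u => GenTree.Node 0 [:: encode_term r t; encode_term r u]
  | Rel R ts =>
      GenTree.Node (cr R).+3
        [seq encode_term r (ts i) | i <- enum 'I_(rarity R)]
  | Imp p q => GenTree.Node 1 [:: encode r p; encode r q]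
  | All p => GenTree.Node 2 [:: encode (option_rank r) p]
  end.

Lemma eq_map_enum n (T : Type) (f g : 'I_n -> T) :
  [seq f i | i <- enum 'I_n] = [seq g i | i <- enum 'I_n] -> f =1 g.
Proof.
by move=> /eq_in_map E i; apply: E; rewrite mem_enum.
Qed.

Lemma encode_term_inj (V : Type) (r : V -> nat) :
  injective r -> injective (encode_term r).
Proof.
move=> r_inj; elim=> [v|g ts IH] [w|h us] //=; first by move=> [] /r_inj ->.
move=> [] /cf_inj gh; move: us; rewrite -gh => us /eq_map_enum E.
by congr (App _); apply: funext => i; apply: IH; exact: E.
Qed.

Lemma encode_inj (V : Type) (r : V -> nat) :
  injective r -> injective (encode r).
Proof.
move=> r_inj phi; elim: phi r r_inj => {V}
  [V|V t u|V R ts|V p IHp q IHq|V p IHp] r r_inj [|t' u'|R' ts'|p' q'|p'] //=.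
- by move=> [] /(encode_term_inj r_inj) -> /(encode_term_inj r_inj) ->.
- move=> [] /cr_inj RR; move: ts'; rewrite -RR => ts' /eq_map_enum E.
  congr (Rel _); apply: funext => i; apply: (encode_term_inj r_inj).
  exact: E.
- by move=> [] /(IHp _ r_inj) -> /(IHq _ r_inj) ->.
- move=> [] /IHp -> // [v|] [w|] //= [] /r_inj -> //.
Qed.

End Countability.

Lemma countable_formula (L : language) (V : Type) :
  countable_language L -> countable [set: V] -> countable [set: formula L V].
Proof.
have inj (T : Type) : countable [set: T] -> exists r : T -> nat, injective r.
  move=> /countable_injP [r ri]; exists r => x y; apply: ri; exact: in_setT.
move=> [/inj [cf cfi] /inj [cr cri]] /inj [r ri].
apply/countable_injP; exists (pickle \o encode cf cr r) => p q _ _ /=.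
by move=> /(pcan_inj pickleK) /(encode_inj cfi cri ri).
Qed.

(** * Small sets *)

Lemma card_le_inj (T U : Type) (A : set T) (B : set U) (f : T -> U) :
  (forall x, A x -> B (f x)) ->
  (forall x y, A x -> A y -> f x = f y -> x = y) -> (A #<= B)%card.
Proof.
move=> fAB f_inj.
have [|g] := injfunPex.2 (_ : exists2 f : T -> U, set_fun A B f & set_inj A f).
  by exists f => // x y /set_mem Ax /set_mem Ay; exact: f_inj.
exact: (inj_card_le g).
Qed.

Lemma countable_sum (V W : Type) :
  countable [set: V] -> countable [set: W] -> countable [set: V + W].
Proof.
move=> /countable_injP [r ri] /countable_injP [r' r'i]; apply/countable_injP.
exists (fun x => match x with inl v => (r v).*2 | inr v => (r' v).*2.+1 end).
have {}ri v w : r v = r w -> v = w by apply: ri; exact: in_setT.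
have {}r'i v w : r' v = r' w -> v = w by apply: r'i; exact: in_setT.
move=> [v|v] [w|w] _ _ => [/double_inj/ri->|/(congr1 odd)|/(congr1 odd)|[]] //=;
  rewrite ?odd_double //.
by move=> /double_inj/r'i->.
Qed.

Lemma countable_set_type (D : Type) (B : set D) : countable B -> countable [set: B].
Proof.
move=> /countable_injP [r ri]; apply/countable_injP.
exists (fun b => r (set_val b)) => b b' _ _ E; apply: val_inj; apply: ri => //.
  exact: valP.
exact: valP.
Qed.

(* A maximal family of disjoint sequences covers [A] up to a finite set. *)
Lemma card_mul_nat (T : Type) (A : set T) :
  infinite_set A -> (A `*` [set: nat] #<= A)%card.
Proof.
move=> Ainf.
pose seqs (B : set T) :=
  [set g : nat -> T | injective g /\ forall n, B (g n)].
have seqs_ex B : infinite_set B -> exists g, seqs B g.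
  move=> /infiniteP /card_leP [g]; exists (fun n => val (g (to_setT n))).
  split=> [m n|n]; last exact: set_valP.
  by move=> /val_inj /(@inj _ _ _ g); rewrite !inE => /(_ I I) /(congr1 val).
have [F [FA Fdisj Fmax]] :=
  ex_maximal_disjoint_subcollection (fun g : nat -> T => range g) (seqs A).
pose R := A `\` \bigcup_(g in F) range g.
have Rfin : finite_set R.
  apply: contrapT => /seqs_ex [g [g_inj gR]].
  apply: (Fmax (F `|` [set g])).
  - split; first by move=> ? ?; left.
    move=> /(_ g (or_intror erefl)) Fg.
    by have [_] := gR 0%N; apply; exists g => //; exists 0%N.
  - by move=> h [/FA //|->]; split=> // n; have [] := gR n.
  - move=> h k [Fh|->] [Fk|->] // [x [[m _ <-] [n _ E]]].
    + by apply: Fdisj => //; exists (h m); split; [exists m|exists n].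
    + by have [_] := gR n; case; rewrite E; exists h => //; exists m.
    + by have [_] := gR m; case; rewrite -E; exists k => //; exists n.
have /countable_injP [c c_inj] := finite_set_countable Rfin.
have [g0 Fg0] : F !=set0.
  apply/set0P/negP => /eqP F0; apply: Ainf; move: Rfin.
  by rewrite /R F0 bigcup_set0 setD0.
(* An element of the finite remainder [R] gets an odd position in the fixed sequence [g0], an
   element [g n] the even position [n.*2] of its own sequence. The position is then paired with the
   second component by [pickle], for which each sequence has room. *)
have code x : exists gn : (nat -> T) * nat, A x ->
    F gn.1 /\ (R x -> gn = (g0, (c x).*2.+1)) /\
    (~ R x -> exists2 n, gn.2 = n.*2 & gn.1 n = x).
  have [Ax|nAx] := EM (A x); last by exists (g0, 0%N).
  have [Rx|nRx] := EM (R x); first by exists (g0, (c x).*2.+1).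
  have [g Fg [n _ gx]] : (\bigcup_(g in F) range g) x.
    by apply: contrapT => n; apply: nRx.
  exists (g, n.*2) => _; split; first exact: Fg.
  by split=> [Rx|_]; [case: (nRx Rx)|exists n].
have [d dP] := choice code.
have d_inj x y : A x -> A y -> d x = d y -> x = y.
  move=> Ax Ay E; have [_ [Rx nRx]] := dP _ Ax; have [_ [Ry nRy]] := dP _ Ay.
  have [rx|rx] := EM (R x); have [ry|ry] := EM (R y).
  - move: E; rewrite (Rx rx) (Ry ry) => -[/double_inj].
    by apply: c_inj; rewrite inE.
  - have [n] := nRy ry; rewrite -E (Rx rx) /= => /(congr1 odd).
    by rewrite /= !odd_double.
  - have [n] := nRx rx; rewrite E (Ry ry) /= => /(congr1 odd).
    by rewrite /= !odd_double.
  - have [n n1 <-] := nRx rx; have [m m1 <-] := nRy ry.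
    by rewrite -E -(double_inj (etrans (esym n1) (etrans (congr1 snd E) m1))).
apply: (card_le_inj (f := fun p => (d p.1).1 (pickle ((d p.1).2, p.2)))).
  by move=> [x n] [/= Ax _]; have [/FA [_ H] _] := dP _ Ax.
move=> [x n] [y m] [/= Ax _] [/= Ay _] /= E.
have [Fx _] := dP _ Ax; have [Fy _] := dP _ Ay.
have dxy : (d x).1 = (d y).1.
  apply: Fdisj => //; exists ((d x).1 (pickle ((d x).2, n))).
  by split; [eexists|rewrite E; eexists].
move: E; rewrite dxy => /((FA _ Fy).1) /(pcan_inj pickleK) [dxy2 ->].
by rewrite (d_inj x y) //; case: (d x) (d y) dxy dxy2 => ? ? [? ?] /= -> ->.
Qed.

Section SmallSets.
Context (kappa : Type).
Hypothesis kappa_big : big kappa.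

Lemma small_le (T U : Type) (A : set T) (B : set U) :
  (A #<= B)%card -> small kappa B -> small kappa A.
Proof.
move=> AB [Bk kB]; split; first exact: card_le_trans Bk.
by move=> kA; apply: kB; exact: card_le_trans AB.
Qed.

Lemma countable_small (T : Type) (A : set T) : countable A -> small kappa A.
Proof.
move=> cA; apply: small_le kappa_big; apply: card_le_trans cA _.
apply: (card_le_inj (f := fun n m => n == m)) => // n m _ _.
by move=> /(congr1 (fun h => h m)); rewrite eqxx => /eqP.
Qed.

Lemma small_mul_nat (T : Type) (A : set T) :
  small kappa A -> small kappa (A `*` [set: nat]).
Proof.
move=> sA; have [fA|iA] := EM (finite_set A).
  by apply: countable_small; apply: countableX => //; exact: finite_set_countable.
exact: small_le (card_mul_nat iA) sA.
Qed.

Lemma small_setU_countable (T : Type) (A B : set T) :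
  small kappa A -> countable B -> small kappa (A `|` B).
Proof.
move=> sA cB; have [fA|iA] := EM (finite_set A).
  apply: countable_small; rewrite -bigcup2inE; apply: bigcup_countable => //.
  by move=> [|[|]] //= _; exact: finite_set_countable.
have /countable_injP [c c_inj] := cB; have [a0 Aa0] := infinite_setN0 iA.
apply: small_le (small_mul_nat sA).
pose f x := if pselect (A x) then (x, 0%N) else (a0, (c x).+1).
apply: (card_le_inj (f := f)) => [x|x y]; rewrite /f.
  by case: pselect.
case: pselect => [Ax|nAx]; case: pselect => [Ay|nAy] //= ; first by move=> _ _ [].
by move=> [//|Bx] [//|By] [/c_inj]; apply; rewrite inE.
Qed.

(** This gathers the coordinates of one representative of every [E]-class in one small parameter
    set. *)
Lemma small_ranges (T V D : Type) (Q : set T) (F : T -> V -> D) :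
  countable [set: V] -> small kappa Q ->
  small kappa (\bigcup_(q in Q) range (F q)).
Proof.
move=> /countable_injP [r r_inj] sQ; apply: small_le (small_mul_nat sQ).
apply: (@card_le_trans _ _ _ (Q `*` [set: V])); last first.
  apply: (card_le_inj (f := fun p => (p.1, r p.2))) => [[q v] []//|].
  by move=> [q v] [q' v'] _ _ /= [-> /r_inj ->]; rewrite ?inE.
apply: card_le_trans (card_image_le (fun p => F p.1 p.2) _).
by apply: subset_card_le => x [q Qq [v _ <-]]; exists (q, v).
Qed.

End SmallSets.

(** * Definable sets and compactness *)

Lemma finite_set_In (T : Type) (F : set T) :
  finite_set F -> exists s : seq T, forall x, F x -> List.In x s.
Proof.
elim/Pchoice: T F => T F /finite_seqP [s ->]; exists s => x /=.
elim: s => //= y s IH; rewrite inE => /orP [/eqP ->|/IH]; first by left.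
by right.
Qed.

Section Definable.
Context (L : language) (D : Type) (N : structure L D).

Definition definable (V : Type) (B : set D) (S : set (V -> D)) :=
  exists phi : formula L (V + B), S = [set a | sat N phi (with_params a)].

Definition join (V W : Type) (a : V -> D) (c : W -> D) (x : V + W) : D :=
  match x with inl v => a v | inr w => c w end.

Lemma join_comp (V W : Type) (s : D -> D) (a : V -> D) (c : W -> D) :
  s \o join a c = join (s \o a) (s \o c).
Proof. by apply: funext => -[]. Qed.

(** The condition on [h] is what a renaming of variables into [V + B] can express. Substitutions of
    parameters for variables, or of variables for parameters, are reduced to it. *)
Lemma definable_sat (V W : Type) (B : set D) (phi : formula L W)
    (h : (V -> D) -> W -> D) :
  (forall w, (exists v, forall a, h a w = a v) \/
             (exists2 b, B b & forall a, h a w = b)) ->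
  definable B [set a | sat N phi (h a)].
Proof.
move=> hP; have /choice [r rP] : forall w, exists x : V + B,
    forall a, with_params a x = h a w.
  move=> w; case: (hP w) => [[v Hv]|[b Bb Hb]]; first by exists (inl v).
  by exists (inr (SigSub (mem_set Bb))).
exists (rename r phi); apply/seteqP; split=> a /=;
  rewrite sat_rename; suff -> : with_params a \o r = h a by [].
all: by apply: funext => w; exact: rP.
Qed.

Lemma definableC (V : Type) (B : set D) (S : set (V -> D)) :
  definable B S -> definable B (~` S).
Proof. by move=> [phi ->]; exists (Neg phi). Qed.

Lemma definableI (V : Type) (B : set D) (S S' : set (V -> D)) :
  definable B S -> definable B S' -> definable B (S `&` S').
Proof.
move=> [phi ->] [psi ->]; exists (And phi psi).
by apply/seteqP; split=> a /sat_and.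
Qed.

Lemma definableU (V : Type) (B : set D) (S S' : set (V -> D)) :
  definable B S -> definable B S' -> definable B (S `|` S').
Proof.
move=> dS dS'; rewrite -[S `|` S']setCK setCU.
by apply: definableC; apply: definableI; exact: definableC.
Qed.

Lemma definable0 (V : Type) (B : set D) : definable B (@set0 (V -> D)).
Proof. by exists Bot; apply/seteqP; split. Qed.

Lemma definableT (V : Type) (B : set D) : definable B [set: V -> D].
Proof. by rewrite -setC0; apply: definableC; exact: definable0. Qed.

Lemma definable_bigI (V : Type) (B : set D) (F : nat -> set (V -> D)) n :
  (forall i, definable B (F i)) ->
  definable B [set a | forall i, (i < n)%N -> F i a].
Proof.
move=> dF; elim: n => [|n IH].
  rewrite [X in definable B X](_ : _ = setT); first exact: definableT.
  by apply/seteqP; split.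
rewrite [X in definable B X](_ : _ =
  [set a | forall i, (i < n)%N -> F i a] `&` F n); first exact: definableI.
apply/seteqP; split=> a /= => [H|[H Hn] i].
  by split=> [i li|]; apply: H => //; rewrite ltnS ltnW.
by rewrite ltnS leq_eqVlt => /orP [/eqP ->|/H].
Qed.

Lemma definable_bigU (V : Type) (B : set D) (F : nat -> set (V -> D)) n :
  (forall i, definable B (F i)) ->
  definable B [set a | exists2 i, (i < n)%N & F i a].
Proof.
move=> dF; rewrite -[X in definable B X]setCK; apply: definableC.
rewrite [X in definable B X](_ : _ =
  [set a | forall i, (i < n)%N -> (~` F i) a]); last first.
  apply/seteqP; split=> a /= H => [i li Fi|[i li]]; last exact: H.
  by apply: H; exists i.
by apply: definable_bigI => i; exact: definableC.
Qed.

Lemma definable_sub (V : Type) (B B' : set D) (S : set (V -> D)) :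
  B `<=` B' -> definable B S -> definable B' S.
Proof.
move=> BB [phi ->]; apply: definable_sat => -[v|b]; first by left; exists v.
by right; exists (set_val b) => //; apply: BB; exact: set_valP.
Qed.

Lemma definable_reindex (V W : Type) (B : set D) (g : V -> W)
    (S : set (V -> D)) :
  definable B S -> definable B [set b : W -> D | S (b \o g)].
Proof.
move=> [phi ->].
rewrite -[X in definable B X]/[set b : W -> D | sat N phi (with_params (b \o g))].
apply: definable_sat => -[v|b].
  by left; exists (g v).
by right; exists (set_val b) => //; exact: set_valP.
Qed.

Lemma definable_fix (V W : Type) (B : set D) (c : W -> D)
    (S : set (V + W -> D)) :
  definable B S -> definable (B `|` range c) [set a | S (join a c)].
Proof.
move=> [phi ->].
rewrite -[X in definable _ X]/[set a | sat N phi (with_params (join a c))].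
apply: definable_sat => -[[v|w]|b].
- by left; exists v.
- by right; exists (c w) => //; right; exists w.
- by right; exists (set_val b) => //; left; exact: set_valP.
Qed.

Lemma definable_fix_left (V W : Type) (B : set D) (c : W -> D)
    (S : set (W + V -> D)) :
  definable B S -> definable (B `|` range c) [set a : V -> D | S (join c a)].
Proof.
move=> [phi ->].
rewrite -[X in definable _ X]/[set a | sat N phi (with_params (join c a))].
apply: definable_sat => -[[w|v]|b].
- by right; exists (c w) => //; right; exists w.
- by left; exists v.
- by right; exists (set_val b) => //; left; exact: set_valP.
Qed.

Lemma definable_automorphism (V : Type) (B : set D) (s t : D -> D)
    (S : set (V -> D)) :
  automorphism N s -> cancel t s -> definable B S ->
  definable (t @` B) [set a | S (s \o a)].
Proof.
move=> sA ts [phi ->].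
pose h (a : V -> D) (x : V + B) :=
  match x with inl v => a v | inr b => t (set_val b) end.
rewrite [X in definable _ X](_ : _ = [set a | sat N phi (h a)]).
  apply: definable_sat => -[v|b]; first by left; exists v.
  by right; exists (t (set_val b)) => //; exists (set_val b) => //;
    exact: set_valP.
apply/seteqP; split=> a /=; rewrite -(sat_automorphism phi (h a) sA);
  suff -> : s \o h a = with_params (s \o a) by [].
all: by apply: funext => -[v|b] //=; rewrite ts.
Qed.

Lemma definable0_automorphism (V : Type) (s : D -> D) (S : set (V -> D))
    (a : V -> D) :
  automorphism N s -> definable set0 S -> S (s \o a) <-> S a.
Proof.
move=> sA [phi ->]; rewrite /= -(sat_automorphism phi (with_params a) sA).
suff -> : with_params (B := set0) (s \o a) = s \o with_params a by [].
by apply: funext => -[v|b] //; case: (set_valP b).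
Qed.

Lemma definable_support (V : Type) (B : set D) (r : V -> nat)
    (S : set (V -> D)) :
  definable B S ->
  exists n, forall a a', (forall v, (r v < n)%N -> a v = a' v) -> S a -> S a'.
Proof.
move=> [phi ->].
have [n Hn] := sat_support N (fun x : V + B => if x is inl v then r v else 0%N)
  phi.
by exists n => a a' E; apply: (Hn _ _ _).1 => -[v|b] //=; exact: E.
Qed.

(** For injective [r] at most one coordinate changes; addressing it by its rank spares a decidable
    equality on [V]. *)
Definition update (V : Type) (r : V -> nat) (d : V -> D) n (y : D) (v : V) : D :=
  if r v == n then y else d v.

Lemma definable_ex (V : Type) (r : V -> nat) n (B : set D)
    (S : set (V -> D)) :
  definable B S -> definable B [set x | exists y, S (update r x n y)].
Proof.
move=> [phi Sphi].
pose sh (x : V + B) : option (V + B) :=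
  if x is inl w then if r w == n then None else Some (inl w) else Some x.
have E x y : with_params (update r x n y) =
    env_cons y (with_params (B := B) x) \o sh.
  by apply: funext => -[w|b] //=; rewrite /update; case: ifP.
exists (Ex (rename sh phi)); apply/seteqP; split=> x.
  move=> [y Sy]; apply/sat_ex; exists y; apply/sat_rename.
  by move: Sy; rewrite Sphi /= E.
move=> /sat_ex [y /sat_rename Sy]; exists y.
by rewrite Sphi /= E.
Qed.

(** Seen as an intersection of definable sets, [Z] is the intersection of all its definable
    supersets. This form avoids handling sets of formulas. *)
Lemma type_definableP (V : Type) (B : set D) (Z : set (V -> D)) :
  type_definable N B Z <->
  forall a, (forall S, definable B S -> Z `<=` S -> S a) -> Z a.
Proof.
split=> [[Phi ->] a H phi Pphi|H].
  apply: (H [set a | sat N phi (with_params a)]); first by exists phi.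
  by move=> b; exact.
exists [set phi | Z `<=` [set a | sat N phi (with_params a)]].
apply/seteqP; split=> [a Za phi|a Ha]; first exact.
by apply: H => S [phi ->]; exact: Ha.
Qed.

Lemma type_definable_definable (V : Type) (B : set D) (S : set (V -> D)) :
  definable B S -> type_definable N B S.
Proof. by move=> dS; apply/type_definableP => a; exact. Qed.

Lemma type_definable_sub (V : Type) (B B' : set D) (Z : set (V -> D)) :
  B `<=` B' -> type_definable N B Z -> type_definable N B' Z.
Proof.
move=> BB /type_definableP H; apply/type_definableP => a Ha.
by apply: H => S dS; apply: Ha; exact: definable_sub dS.
Qed.

Lemma type_definableI (V : Type) (B : set D) (Z Z' : set (V -> D)) :
  type_definable N B Z -> type_definable N B Z' ->
  type_definable N B (Z `&` Z').
Proof.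
move=> /type_definableP H /type_definableP H'; apply/type_definableP => a Ha.
split; [apply: H|apply: H'] => S dS ZS; apply: Ha => // b [? ?]; exact: ZS.
Qed.

Lemma type_definable_reindex (V W : Type) (B : set D) (g : V -> W)
    (Z : set (V -> D)) :
  type_definable N B Z -> type_definable N B [set b : W -> D | Z (b \o g)].
Proof.
move=> /type_definableP H; apply/type_definableP => a Ha.
apply: H => S dS ZS; apply: (Ha [set b : W -> D | S (b \o g)]).
  exact: definable_reindex.
by move=> b /ZS.
Qed.

(** * Realization of ultrafilters by saturation, and compactness *)

Section Realization.
Context (kappa : Type).
Hypotheses (kappa_big : big kappa) (Nsat : saturated kappa N).
Hypothesis D_inh : inhabited D.
Context (V : Type) (r : V -> nat).
Hypothesis r_inj : injective r.

Let agree n (a a' : V -> D) := forall v, (r v < n)%N -> a v = a' v.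
Let supp n (S : set (V -> D)) := forall a a', agree n a a' -> S a -> S a'.
Let upd := update r.

Context (F : set_system (V -> D)) (FU : UltraFilter F) (B : set D).
Hypothesis sB : small kappa B.

(* [d] satisfies the part of the type of [F] over [B] that concerns the
   variables of rank less than [n]. *)
Let good n d := forall S, definable B S -> supp n S -> F S -> S d.

(** Saturation realizes types in one variable only. The coordinate of rank [n] is therefore chosen
    alone, with the coordinates of lower rank as additional parameters. *)
Let good_step n d : good n d -> exists d', agree n d d' /\ good n.+1 d'.
Proof.
move=> gd; have [[v rv]|nov] := EM (exists v, r v = n); last first.
  exists d; split=> // S dS sS; apply: gd => // a a' aa'; apply: sS => v.
  rewrite ltnS leq_eqVlt => /orP [/eqP rv|]; last exact: aa'.
  by case: nov; exists v.
pose B' := B `|` d @` [set w | (r w < n)%N].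
have sB' : small kappa B'.
  apply: small_setU_countable => //.
  apply: sub_countable (card_image_le _ _) _.
  by apply/countable_injP; exists r => ? ? _ _; exact: r_inj.
have updK a : upd a n (a v) = a.
  apply: funext => w; rewrite /upd /update; case: eqP => // rw.
  by congr (a _); apply: r_inj; rewrite rv rw.
have agree_upd a a' y : agree n a a' -> agree n.+1 (upd a n y) (upd a' n y).
  move=> aa' w; rewrite ltnS leq_eqVlt /upd /update => /orP [->|lw] //.
  by rewrite (aa' _ lw).
(* The type that the new coordinate has to realize: the consequences of the members of [F] that
   concern ranks up to [n], once the lower coordinates are those of [d]. *)
pose q : set (formula L (unit + B')) := [set psi | exists S,
  [/\ definable B S, supp n.+1 S, F S &
      forall y, S (upd d n y) -> sat N psi (with_params (fun=> y))]].
have q_complete : complete_types N unit B' q.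
  split=> [G /finite_set_In [s Gs] Gq|psi].
    have [S [dS sS FS HS]] : exists S, [/\ definable B S, supp n.+1 S, F S &
        forall y, S (upd d n y) -> forall psi, List.In psi s -> q psi ->
          sat N psi (with_params (fun=> y))].
      elim: s {Gs} => [|psi s [S [dS sS FS HS]]].
        by exists setT; split=> //; [exact: definableT|exact: filterT].
      have [[S' [dS' sS' FS' HS']]|nq] := EM (q psi); last first.
        by exists S; split=> // y /HS Hy p [<-|/Hy].
      exists (S `&` S'); split; first exact: definableI.
      - by move=> a a' aa' [? ?]; split; [exact: sS aa' _|exact: sS' aa' _].
      - exact: filterI.
      - by move=> y [/HS Hy S'y] p [<- _|/Hy //]; exact: HS'.
    (* Projecting away the coordinate of rank [n] enlarges [S], so the projection is in [F], and it
       only concerns ranks below [n]; thus [good n d] applies to it. *)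
    have [y Sy] : [set x | exists y, S (upd x n y)] d.
      apply: gd.
      + exact: definable_ex.
      + by move=> a a' aa' [y Sy]; exists y; apply: sS Sy; exact: agree_upd.
      + by apply: filterS FS => x Sx; exists (x v); rewrite updK.
    by exists (fun=> y) => psi /= Gpsi; apply: HS => //; [exact: Gs|exact: Gq].
  have /choice [w_ wP] : forall b : B', exists w,
      ~ B (set_val b) -> (r w < n)%N /\ d w = set_val b.
    move=> b; have [Bb|nBb] := EM (B (set_val b)); first by exists v.
    by case: (set_valP b) => [//|[w lw dw]]; exists w.
  (* Parameters taken from [d] are turned back into variables. The formula [psi] then defines a set
     over [B] alone, and the ultrafilter decides this set. *)
  pose h (x : V -> D) (z : unit + B') : D := match z with
    | inl _ => x v
    | inr b => if pselect (B (set_val b)) then set_val b else x (w_ b) end.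
  have hd y : h (upd d n y) = with_params (fun=> y).
    apply: funext => -[u|b] /=; first by rewrite /upd /update rv eqxx.
    case: pselect => // nBb; have [lw dw] := wP b nBb.
    by rewrite /upd /update ltn_eqF.
  pose S := [set x | sat N psi (h x)].
  have dS : definable B S.
    apply: definable_sat => -[u|b]; first by left; exists v.
    have [Bb|nBb] := EM (B (set_val b)).
      by right; exists (set_val b) => // a /=; case: pselect.
    by left; exists (w_ b) => a /=; case: pselect.
  have sS : supp n.+1 S.
    move=> a a' aa'; rewrite /S /=; suff -> : h a = h a' by [].
    apply: funext => -[u|b] /=; first by rewrite aa' ?rv.
    by case: pselect => // nBb; rewrite aa' // ltnS ltnW // (wP b nBb).1.
  have [FS|FS] := in_ultra_setVsetC S FU.
    by left; exists S; split=> // y; rewrite /S /= hd.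
  right; exists (~` S); split=> //; first exact: definableC.
    move=> a a' aa' nSa Sa'; apply: nSa; apply: sS Sa' => w lw.
    by rewrite aa'.
  by move=> y; rewrite /S /= hd.
have [a ap] := Nsat sB' (exist _ q (mem_set q_complete)).
have aq : tp_set N a = q by have := congr1 val ap.
exists (upd d n (a tt)); split.
  by move=> w lw; rewrite /upd /update ltn_eqF.
move=> S dS sS FS.
(* The value at ranks above [n] is arbitrary, because [S] depends on ranks up to [n] only. *)
pose g (c : unit -> D) (w : V) : D := if (r w < n)%N then d w else c tt.
have gE c : agree n.+1 (g c) (upd d n (c tt)).
  move=> w; rewrite ltnS leq_eqVlt /g /upd /update => /orP [/eqP ->|lw].
    by rewrite ltnn eqxx.
  by rewrite lw ltn_eqF.
have [phi Sphi] := dS.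
have [psi Epsi] : definable B' [set c : unit -> D | S (g c)].
  have -> : [set c : unit -> D | S (g c)] =
      [set c : unit -> D | sat N phi (with_params (g c))] by rewrite Sphi.
  apply: definable_sat => -[w|b] /=.
    have [lw|lw] := boolP (r w < n)%N.
      by right; exists (d w) => [|c]; [right; exists w|rewrite /g lw].
    by left; exists tt => c; rewrite /g (negbTE lw).
  by right; exists (set_val b) => //; left; exact: set_valP.
have : q psi.
  exists S; split=> // y Sy.
  have : [set c : unit -> D | S (g c)] (fun=> y).
    by apply: sS Sy => w lw; rewrite (gE (fun=> y)).
  by rewrite Epsi.
rewrite -aq => /= ha; have {}ha : [set c : unit -> D | S (g c)] a by rewrite Epsi.
by apply: sS ha; exact: gE.
Qed.

Lemma realize_ultrafilter : exists d : V -> D,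
  forall S, definable B S -> F S -> S d.
Proof.
have [d0] := D_inh.
have /choice [nx nxP] : forall nd : nat * (V -> D), exists d',
    good nd.1 nd.2 -> agree nd.1 nd.2 d' /\ good nd.1.+1 d'.
  move=> [n d]; have [gd|ngd] := EM (good n d); last by exists d.
  by have [d' ?] := good_step gd; exists d'.
pose fix ds n := if n is m.+1 then nx (m, ds m) else fun=> d0.
have gds n : good n (ds n).
  elim: n => [|n IH]; last exact: (nxP (n, ds n) IH).2.
  move=> S dS sS FS; have [x Sx] := filter_ex FS.
  exact: sS Sx.
have ds_agree n m : (n <= m)%N -> agree n (ds n) (ds m).
  move=> /subnK <-; elim: (m - n)%N => // k IH v lv.
  rewrite (IH v lv) addSn /=.
  by apply: (nxP (_, _) (gds _)).1 => /=; exact: leq_trans lv (leq_addl _ _).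
(* The coordinate [v] is settled from stage [(r v).+1] on. Since [S] has bounded support, the
   diagonal cannot be told from a single stage by [S]. *)
exists (fun v => ds (r v).+1 v) => S dS FS.
have [n Hn] := definable_support r dS.
apply: (Hn (ds n)); first by move=> v lv; rewrite -(ds_agree (r v).+1 n).
exact: gds.
Qed.

End Realization.

Lemma compactness (kappa V : Type) (B : set D) (Z : nat -> set (V -> D)) :
  big kappa -> saturated kappa N -> countable [set: V] -> small kappa B ->
  (forall n, type_definable N B (Z n)) ->
  (forall n, Z n.+1 `<=` Z n) -> (forall n, Z n !=set0) ->
  exists a, forall n, Z n a.
Proof.
move=> kbig Nsat /countable_injP [r ri] sB tZ Zdec Zne.
have r_inj : injective r by move=> x y; apply: ri; exact: in_setT.
have Zmon n m : (n <= m)%N -> Z m `<=` Z n.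
  by move=> /subnK <-; elim: (m - n)%N => // k IH a /Zdec /IH.
have FF : Filter (filter_from setT Z).
  apply: filter_fromT_filter; first by exists 0%N.
  move=> i j; exists (maxn i j) => a Za.
  by split; apply: Zmon Za; rewrite ?leq_maxl ?leq_maxr.
have [F [FU ZF]] := ultraFilterLemma (filter_from_proper FF (fun n _ => Zne n)).
have [d dP] : exists d : V -> D, forall S, definable B S -> F S -> S d.
  (* A coordinate of a given tuple shows that [D] is inhabited. If [V] is empty, then there is only
     one tuple. *)
  have [[v]|noV] := EM (inhabited V).
    have [a _] := Zne 0%N.
    exact: (realize_ultrafilter kbig Nsat (inhabits (a v)) r_inj FU sB).
  have [a _] := Zne 0%N; exists a => S _ FS; have [b Sb] := filter_ex FS.
  suff -> : a = b by [].
  by apply: funext => v; case: noV.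
exists d => n; have /type_definableP := tZ n; apply => S dS ZS.
by apply: dP => //; apply: ZF; exists n.
Qed.

End Definable.

(** * Points with the same type over a model *)

Section Monster.
Context (L : language) (D : Type) (N : structure L D).

Lemma homogeneous_tuple (kappa W : Type) (x y : W -> D) :
  big kappa -> homogeneous kappa N -> countable [set: W] ->
  (forall S, definable N set0 S -> S x -> S y) ->
  exists2 s, automorphism N s & s \o x = y.
Proof.
move=> kbig Nhom cW xy.
have {}xy phi : sat N phi x -> sat N phi y.
  apply: (xy [set z | sat N phi z]).
  by apply: (@definable_sat _ _ N _ _ set0 phi id) => w; left; exists w.
have sB : small kappa (range x).
  by apply: countable_small => //; exact: sub_countable (card_image_le _ _) cW.
(* The tuple [x] may repeat a value, so an index is chosen for each value. The choice is harmless: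
   equality of two coordinates is a formula, so [y] repeats values wherever [x] does. *)
have /choice [g gP] : forall b : range x, exists w, x w = set_val b.
  by move=> b; have [w _ xw] := set_valP b; exists w.
have [|s sA sP] := Nhom _ sB (y \o g).
  move=> phi; rewrite (_ : set_val = x \o g); last by apply: funext => b /=.
  split=> /sat_rename H; apply/sat_rename; first exact: xy.
  by apply: contrapT => /(xy (Neg (rename g phi))); exact.
exists s => //; apply: funext => w /=.
pose b : range x := SigSub (mem_set (imageT x w)).
rewrite (sP b : s (x w) = _) /=.
exact: (xy (Eq (Var L (g b)) (Var L w)) (gP b)).
Qed.

Lemma tarski_vaught (M : set D) (phi : formula L (option M)) (y : D) :
  elementary_sub N M -> sat N phi (env_cons y set_val) ->
  exists m : M, sat N phi (env_cons (set_val m) set_val).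
Proof.
move=> [NM NMP] phiy.
have /NMP /sat_ex [m Hm] : sat N (Ex phi) set_val by apply/sat_ex; exists y.
exists m; have : sat NM (rename (env_cons m id) phi) id.
  by apply/sat_rename.
move=> /NMP /sat_rename; congr (sat N phi _).
by apply: funext => -[].
Qed.

(** * Ultrafilters concentrated on a model *)

Section Coheir.
Context (M : set D) (V : Type).
Hypotheses (M_el : elementary_sub N M) (cV : countable [set: V]).

(** Induction on the bound of the support: the coordinate of highest rank is projected away, the
    others are found in [M], and the missing one is supplied by the Tarski-Vaught test. *)
Lemma definable_meets_submodel (S : set (V -> D)) :
  definable N M S -> S !=set0 -> exists2 x, S x & forall v, M (x v).
Proof.
have /countable_injP [r ri] := cV.
have {ri} r_inj : injective r by move=> x y; apply: ri; exact: in_setT.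
move=> dS; have [n] := definable_support r dS.
elim: n S dS => [|n IH] S dS sS [a Sa].
  have [[v]|nv] := EM (inhabited V); last first.
    by exists a => // v; case: nv.
  (* The trivial equation yields some element of [M]. As [S] has empty support, it can fill every
     coordinate. *)
  have [m _] := @tarski_vaught M (Eq (Var L None) (Var L None)) (a v) M_el erefl.
  by exists (fun=> set_val m) => [|w]; [exact: sS Sa|exact: set_valP].
have [[v rv]|nov] := EM (exists v, r v = n); last first.
  apply: IH => //; last by exists a.
  move=> x x' xx'; apply: sS => v; rewrite ltnS leq_eqVlt => /orP [/eqP rv|].
    by case: nov; exists v.
  exact: xx'.
have [|x x' xx' [y Sy]||x [y Sy] Mx] := IH [set x | exists y, S (update r x n y)].
- exact: definable_ex.
- exists y; apply: sS Sy => w; rewrite ltnS leq_eqVlt /update => /orP [->//|lw].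
  by rewrite xx'.
- exists a, (a v); suff -> : update r a n (a v) = a by [].
  apply: funext => w; rewrite /update; case: eqP => // rw.
  by congr (a _); apply: r_inj; rewrite rv rw.
have [phi Sphi] := dS.
pose sh (z : V + M) : option M := match z with
  | inl w => if r w == n then None else Some (SigSub (mem_set (Mx w)))
  | inr b => Some b end.
have shE z : env_cons z set_val \o sh = with_params (update r x n z).
  by apply: funext => -[w|b] //=; rewrite /update; case: eqP.
have [|m] := @tarski_vaught M (rename sh phi) y M_el.
  by apply/sat_rename; rewrite shE; move: Sy; rewrite Sphi.
move=> /sat_rename; rewrite shE => Sm; exists (update r x n (set_val m)).
  by rewrite Sphi.
by move=> w; rewrite /update; case: eqP => // _; exact: set_valP.
Qed.

(** The traces on tuples from [M] of the [M]-definable sets containing [a] are nonempty and closed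
    under intersection, so they generate a proper filter. *)
Lemma coheir_exists (a : V -> D) :
  exists F : set_system (V -> D), [/\ UltraFilter F,
    forall S, definable N M S -> S a -> F S & F [set x | forall v, M (x v)]].
Proof.
pose Fam := [set S : set (V -> D) | definable N M S /\ S a].
pose B (S : set (V -> D)) := S `&` [set x | forall v, M (x v)].
have FF : Filter (filter_from Fam B).
  apply: filter_from_filter; first by exists setT; split=> //; exact: definableT.
  move=> S S' [dS Sa] [dS' S'a]; exists (S `&` S').
    by split; [exact: definableI|].
  by move=> x [[? ?] ?].
have PF : ProperFilter (filter_from Fam B).
  apply: filter_from_proper => S [dS Sa].
  by have [|x Sx Mx] := definable_meets_submodel dS; [exists a|exists x].
have [F [FU BF]] := ultraFilterLemma PF; exists F; split=> // [S dS Sa|].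
  by apply: BF; exists S => // x [].
by apply: BF; exists setT => [|x []] //; split=> //; exact: definableT.
Qed.

(** Otherwise some tuple [x] from [M] would satisfy [R] with [c] but not with [d], and
    [R (join x _)] would be an [M]-definable set separating them. *)
Lemma coheir_invariant (F : set_system (V -> D)) (W : Type) (c d : W -> D)
    (R : set (V + W -> D)) :
  UltraFilter F -> F [set x | forall v, M (x v)] ->
  (forall S, definable N M S -> S c -> S d) -> definable N set0 R ->
  F [set x | R (join x c)] -> F [set x | R (join x d)].
Proof.
move=> FU FM cd dR Fc.
have [//|Fd] := in_ultra_setVsetC [set x | R (join x d)] FU.
have [x [[Rc nRd] Mx]] := filter_ex (filterI (filterI Fc Fd) FM).
case: nRd; apply: (cd [set z | R (join x z)]) => //.
apply: definable_sub (definable_fix_left x dR).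
by move=> y [//|[v _ <-]]; exact: Mx.
Qed.
End Coheir.

Lemma coheir_realization (V : Type) (F : set_system (V -> D)) (B : set D) (d : V -> D)
    (W : Type) (z : W -> D) (R : set (V + W -> D)) :
  UltraFilter F -> (forall S, definable N B S -> F S -> S d) ->
  range z `<=` B -> definable N set0 R ->
  R (join d z) <-> F [set x | R (join x z)].
Proof.
move=> FU dF zB dR.
have dz : definable N B [set x | R (join x z)].
  by apply: definable_sub (definable_fix z dR) => y [//|/zB].
split=> [Rd|FR]; last exact: dF dz FR.
have [//|nFR] := in_ultra_setVsetC [set x | R (join x z)] FU.
by have := dF _ (definableC dz) nFR Rd.
Qed.

Section Bounded.
Context (kappa V : Type) (A M : set D) (X : set (V -> D)).
Context (E : set ((V -> D) * (V -> D))).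
Hypotheses (kbig : big kappa) (Nsat : saturated kappa N)
  (Nhom : homogeneous kappa N) (D_inh : inhabited D).
Hypotheses (cV : countable [set: V]) (cM : countable M) (AM : A `<=` M)
  (M_el : elementary_sub N M) (tX : type_definable N A X).
Hypotheses (E_inv : empty_invariant N (rel_set E)) (E_eq : equiv_on X E)
  (E_bd : bounded_equiv kappa X E).

Let cVV : countable [set: V + V] := countable_sum cV cV.

(** By homogeneity, pairs with the same type over the empty set are conjugate, and [E] is
    invariant. *)
Lemma equiv_transfer (x y x' y' : V -> D) :
  (forall R, definable N set0 R -> R (join x y) -> R (join x' y')) ->
  E (x, y) -> E (x', y').
Proof.
move=> H Exy; have [s sA sP] := homogeneous_tuple kbig Nhom cVV H.
by have := (E_inv sA (join x y)).1 Exy; rewrite sP.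
Qed.

(* The ultrafilter [F] gives a global coheir of tp(a/M).  A realization [c] of
   [F] over representatives of all classes is equivalent to one of them, hence
   two successive realizations of [F] are equivalent. *)
Lemma equiv_of_type (a b : V -> D) : X a -> X b ->
  (forall S, definable N M S -> S a -> S b) -> E (a, b).
Proof.
move=> Xa Xb ab; have [Erefl Esym Etrans] := E_eq.
have [F [FU Fa FM]] := coheir_exists M_el cV a.
have /countable_injP [r ri] := cV.
have {ri} r_inj : injective r by move=> x y; apply: ri; exact: in_setT.
have realize B : small kappa B -> exists d, X d /\
    forall S, definable N (B `|` M) S -> F S -> S d.
  move=> sB; have sBM : small kappa (B `|` M) by exact: small_setU_countable.
  have [d dP] := realize_ultrafilter kbig Nsat D_inh r_inj FU sBM.
  exists d; split=> //; have /type_definableP := tX; apply => S dS XS.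
  have dMS : definable N M S by exact: definable_sub dS.
  apply: dP; last by apply: Fa => //; exact: XS.
  by apply: definable_sub dMS => y; right.
have srange (z : V -> D) : small kappa (range z).
  by apply: countable_small => //; exact: sub_countable (card_image_le _ _) cV.
have /choice [rep repP] : forall K, exists x,
    quotient_set X E K -> X x /\ K = class_of X E x.
  move=> K; have [[x Xx <-]|nK] := EM (quotient_set X E K); first by exists x.
  by exists a.
have [c [Xc cP]] := realize _ (small_ranges kbig rep cV E_bd).
pose b0 := rep (class_of X E c).
have QK : quotient_set X E (class_of X E c) by exists c.
have [Xb0 cb0] := repP _ QK.
have Ecb : E (c, b0).
  have : class_of X E b0 b0 by split=> //; exact: Erefl.
  by rewrite -cb0 => -[].
have [c' [Xc' c'P]] := realize _ (small_setU_countable kbig (srange b0)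
  (sub_countable (card_image_le c setT) cV)).
have Ec'b : E (c', b0).
  apply: equiv_transfer Ecb => R dR.
  rewrite (coheir_realization FU cP _ dR); last first.
    by move=> y yb; left; exists (class_of X E c).
  by rewrite (coheir_realization FU c'P _ dR) // => y yb; left; left.
have Ec'c : E (c', c) by apply: (Etrans _ b0) => //; exact: Esym.
(* All of [a], [b] and [c] have the same type over [M] and [F] is [M]-invariant. So a realization
   [d] over [a] and [b] stands to each of them as [c'] stands to [c], and links them. *)
have [d [Xd dP]] := realize _ (small_setU_countable kbig (srange a)
  (sub_countable (card_image_le b setT) cV)).
have cM_a S : definable N M S -> S c -> S a.
  move=> dS Sc; apply: contrapT => nSa.
  have : (~` S) c by apply: cP; [apply: definable_sub (definableC dS) => y; right|
    apply: Fa nSa; exact: definableC].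
  exact.
have Ed z : range z `<=` range a `|` range b ->
    (forall S, definable N M S -> S c -> S z) -> E (d, z).
  move=> zab cz; apply: equiv_transfer Ec'c => R dR.
  rewrite (coheir_realization FU c'P _ dR); last by move=> y yc; left; right.
  rewrite (coheir_realization FU dP _ dR); last by move=> y /zab yab; left.
  exact: (coheir_invariant FU FM cz dR).
apply: (Etrans _ d) => //.
  by apply: Esym => //; apply: Ed => // y; left.
by apply: Ed => [y|S dS Sc]; [right|apply: ab => //; exact: cM_a].
Qed.

End Bounded.
End Monster.

(** * Maximal invariant ideals *)

Section InvariantIdeal.
Context (Om : Type) (C : set Om) (G : set (Om -> Om)).
Hypotheses (Gid : G id) (Gcomp : forall g h, G g -> G h -> G (g \o h))
  (GC : forall g x, G g -> C x -> C (g x)).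

Definition invariant_ideal (J : set (set Om)) :=
  [/\ forall S S', J S -> S' `<=` S -> J S',
      forall S S', J S -> J S' -> J (S `|` S'),
      forall g S, G g -> J S -> J [set x | S (g x)] &
      ~ J C].

Definition translates (g : nat -> Om -> Om) m (S : set Om) : set Om :=
  [set x | exists2 i, (i < m)%N & S (g i x)].

(* By maximality, a set [S] outside the ideal generates together with it an
   improper ideal, so finitely many translates of [S] cover [C] up to the
   ideal. *)
Lemma maximal_invariant_ideal : C !=set0 -> exists J,
  [/\ invariant_ideal J, J (~` C) &
      forall S, ~ J S -> exists m g,
        (forall i, G (g i)) /\ J (C `\` translates g m S)].
Proof.
move=> [a0 Ca0].
have [|J [[Jsub JU Jtr JC] Jmax]] := @Zorn_bigcup _ invariant_ideal.
  move=> F FP Ftot; split.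
  - by move=> S S' [J FJ JS] SS; exists J => //; have [H _ _ _] := FP _ FJ;
      exact: H SS.
  - move=> S S' [J FJ JS] [J' FJ' J'S']; have [JJ|JJ] := Ftot _ _ FJ FJ'.
      by exists J' => //; have [_ H _ _] := FP _ FJ'; apply: H => //; exact: JJ.
    by exists J => //; have [_ H _ _] := FP _ FJ; apply: H => //; exact: JJ.
  - move=> g S Gg [J FJ JS]; exists J => //; have [_ _ H _] := FP _ FJ.
    exact: H.
  - by move=> [J FJ]; have [_ _ _] := FP _ FJ.
(* The empty family satisfies [invariant_ideal], as the empty chain in Zorn's lemma demands. The
   empty set is therefore added by hand until it is known to lie in [J]. *)
pose small R := R = set0 \/ J R.
have smallU R R' : small R -> small R' -> small (R `|` R').
  move=> [->|JR] [->|JR']; rewrite ?set0U ?setU0; [by left|by right|by right|].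
  by right; exact: JU.
pose gen (S : set Om) := [set R | exists R0 m g, [/\ small R0,
  forall i, G (g i) & R `<=` R0 `|` translates g m S]].
have dich S : J S \/ gen S C.
  have [JS|nJS] := EM (J S); first by left.
  right; apply: contrapT => nC; apply: (Jmax (gen S)).
    split; last first.
      by move=> H; apply: nJS; apply: H; exists set0, 1%N, (fun=> id);
        split; [left| |move=> x Sx; right; exists 0%N].
    by move=> R JR; exists R, 0%N, (fun=> id); split; [right| |move=> x; left].
  split=> //.
  - move=> R R' [R0 [m [g [sR Gg RR]]]] R'R.
    by exists R0, m, g; split=> // x /R'R /RR.
  - move=> R R' [R0 [m [g [sR Gg RR]]]] [R0' [m' [g' [sR' Gg' RR']]]].
    exists (R0 `|` R0'), (m + m')%N,
      (fun i => if (i < m)%N then g i else g' (i - m)%N).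
    split; [exact: smallU|by move=> i; case: ifP|].
    move=> x [/RR|/RR'] [Rx|[i li Sx]].
    + by left; left.
    + by right; exists i; [exact: ltn_addr|rewrite li].
    + by left; right.
    + right; exists (m + i)%N; first by rewrite ltn_add2l.
      by rewrite ltnNge leq_addr /= addKn.
  - move=> h R Gh [R0 [m [g [sR Gg RR]]]].
    exists [set x | R0 (h x)], m, (fun i => g i \o h); split.
    + by case: sR => [->|JR0]; [left|right; exact: Jtr].
    + by move=> i; exact: Gcomp.
    + by move=> x /RR [Rx|[i li Sx]]; [left|right; exists i].
have J0 : small set0 -> J set0.
  move=> _; have [//|[R0 [m [g [sR Gg CR]]]]] := dich set0.
  case: sR => [R00|JR0]; first by move: CR; rewrite R00 => /(_ _ Ca0) [//|[i _ []]].
  exact: Jsub JR0 _.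
have sJ R : small R -> J R by move=> [->|//]; apply: J0; left.
exists J; split=> //.
(* Elements of [G] map [C] into itself, so translates of the complement of [C] cannot help to cover
   [C]. *)
- have [//|[R0 [m [g [/sJ JR0 Gg CR]]]]] := dich (~` C).
  case: JC; apply: Jsub JR0 _ => x Cx; have [//|[i _]] := CR _ Cx.
  by case; exact: GC.
- move=> S nJS; have [//|[R0 [m [g [/sJ JR0 Gg CR]]]]] := dich S.
  exists m, g; split=> //; apply: Jsub JR0 _ => x [Cx nx].
  by have [|/nx] := CR _ Cx.
Qed.

(** * Sets outside a maximal invariant ideal *)

Section Positive.
Context (J : set (set Om)) (T : nat -> nat -> Om -> Om -> Prop).
Hypotheses (Jideal : invariant_ideal J) (JC : J (~` C)).
Hypothesis Jcover : forall S, ~ J S -> exists m g,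
  (forall i, G (g i)) /\ J (C `\` translates g m S).
Hypotheses (Ginv : forall g, G g -> exists2 h, G h & cancel g h /\ cancel h g)
  (Gtrans : forall x y, C x -> C y -> exists2 g, G g & g x = y).
Hypotheses
  (Tdec : forall n k x y, T n k.+1 x y -> T n k x y)
  (Tsym : forall n k x y, T n k x y -> T n k y x)
  (Trefl : forall n k x, C x -> T n k x x)
  (TG : forall n k g x y, G g -> T n k (g x) (g y) <-> T n k x y)
  (Tthin : forall n j, exists k, forall x y z, C x -> C y -> C z ->
     T n k x y -> T n k y z -> T n.+1 j x z)
  (Tdisp : forall g, G g -> exists n, forall k x, C x -> T n k x (g x))
  (Ttb : forall ks : nat -> nat, exists N m (p : nat -> Om),
     (forall i, C (p i)) /\ forall x, C x -> exists2 i, (i < m)%N &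
       exists2 n, (n < N)%N & T n (ks n) (p i) x)
  (Tunb : forall n, exists k x y, [/\ C x, C y & ~ T n k x y]).

Let Jsub S S' : J S -> S' `<=` S -> J S'.
Proof. by case: Jideal => H _ _ _; exact: H. Qed.

Let JU S S' : J S -> J S' -> J (S `|` S').
Proof. by case: Jideal => _ H _ _; exact: H. Qed.

Let Jtr g S : G g -> J S -> J [set x | S (g x)].
Proof. by case: Jideal => _ _ H _; exact: H. Qed.

Let JnC : ~ J C.
Proof. by case: Jideal. Qed.

Let J0 : J set0.
Proof. exact: Jsub JC _. Qed.

Let JbigU m (F : nat -> set Om) :
  (forall i, (i < m)%N -> J (F i)) -> J [set x | exists2 i, (i < m)%N & F i x].
Proof.
elim: m => [|m IH] JF; first by apply: Jsub J0 _ => x [].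
apply: Jsub (JU (IH _) (JF m (ltnSn m))) _ => [i li|x [i]].
  by apply: JF; exact: ltnW.
rewrite ltnS leq_eqVlt => /orP [/eqP ->|li] Fx; first by right.
by left; exists i.
Qed.

Let Tmon n k k' x y : (k <= k')%N -> T n k' x y -> T n k x y.
Proof.
by move=> /subnK <-; elim: (k' - k)%N => // m IH; rewrite addSn => /Tdec /IH.
Qed.

Let Tup n m j : (n <= m)%N ->
  exists k, forall x y, C x -> C y -> T n k x y -> T m j x y.
Proof.
move=> /subnK <-; elim: (m - n)%N j => [|d IH] j; first by exists j.
have [k kP] := Tthin (d + n) j; have [k' k'P] := IH k.
exists k' => x y Cx Cy Txy; apply: (kP x y y) => //; last exact: Trefl.
exact: k'P.
Qed.

Let Tcomp n m M j : (n <= M)%N -> (m <= M)%N -> exists k, forall x y z,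
  C x -> C y -> C z -> T n k x y -> T m k y z -> T M.+1 j x z.
Proof.
move=> nM mM; have [k kP] := Tthin M j.
have [k1 k1P] := Tup k nM; have [k2 k2P] := Tup k mM.
exists (maxn k1 k2) => x y z Cx Cy Cz Txy Tyz; apply: (kP x y z) => //.
  by apply: k1P => //; exact: Tmon (leq_maxl _ _) Txy.
by apply: k2P => //; exact: Tmon (leq_maxr _ _) Tyz.
Qed.

Definition thick_ball (ks : nat -> nat) N a : set Om :=
  [set x | exists2 n, (n < N)%N & T n (ks n) a x].

(** By transitivity, finitely many translates of such a ball cover [C]. *)
Lemma thick_ball_positive ks a : C a -> exists N, ~ J (thick_ball ks N a).
Proof.
move=> Ca; have [N [m [p [Cp pP]]]] := Ttb ks; exists N => JB; apply: JnC.
have /choice [g gP] : forall i, exists g, G g /\ g (p i) = a.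
  by move=> i; have [g Gg ga] := Gtrans (Cp i) Ca; exists g.
pose F i := [set x | thick_ball ks N a (g i x)].
apply: (@Jsub [set x | exists2 i, (i < m)%N & F i x]).
  by apply: JbigU => i _; apply: Jtr => //; exact: (gP i).1.
move=> x Cx; have [i li [n ln Tx]] := pP x Cx.
by exists i => //; exists n => //; rewrite -(gP i).2 TG //; exact: (gP i).1.
Qed.

(** The fineness [ks] is chosen to work at all of the finitely many points [g i a] at once, before
    it is known around which of them a ball meets [S] outside the ideal. *)
Lemma positive_in_open S (X V : set Om) : ~ J S -> C !=set0 ->
  (forall a n, C a -> exists k, forall x, X x -> T n k a x -> V x) ->
  exists ks N a, [/\ C a, ~ J (S `&` thick_ball ks N a) &
    X `&` thick_ball ks N a `<=` V].
Proof.
move=> nJS [a Ca] HV; have [m [g [Gg Jg]]] := Jcover nJS.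
have /choice [k kP] : forall ni : nat * nat, exists k, forall x, X x ->
    T ni.1 k (g ni.2 a) x -> V x.
  by move=> [n i]; apply: HV; exact: GC.
pose ks n := (\max_(i < m) k (n, val i))%N.
have [N nJB] := thick_ball_positive ks Ca.
have [i [li nJi]] : exists i, (i < m)%N /\ ~ J (S `&` thick_ball ks N (g i a)).
  apply: contrapT => H; apply: nJB.
  pose F i := [set x | (S `&` thick_ball ks N (g i a)) (g i x)].
  have JF : J [set x | exists2 i, (i < m)%N & F i x].
    apply: JbigU => i li; apply: Jtr => //; apply: contrapT => n; apply: H.
    by exists i.
  apply: Jsub (JU (JU Jg JC) JF) _ => x Bx.
  have [Cx|nCx] := EM (C x); last by left; right.
  have [[i li Sx]|nx] := EM (translates g m S x); last by left; left.
  right; exists i => //; split=> //; case: Bx => n ln Tx.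
  by exists n => //; rewrite TG.
exists ks, N, (g i a); split=> //; first exact: GC.
move=> x [Xx [n ln Tx]]; apply: (kP (n, i)) => //=.
by apply: Tmon Tx; exact: (leq_bigmax (Ordinal li)).
Qed.

(** If every radius [n] had a bad fineness [ks n], the finite cover belonging to [ks] would cut [S]
    into pieces in [J]. *)
Lemma positive_ball S : ~ J S ->
  exists n, forall k, exists2 c, C c & ~ J (S `&` T n k c).
Proof.
move=> nJS; apply: contrapT => H.
have /choice [ks ksP] : forall n, exists k, forall c, C c -> J (S `&` T n k c).
  move=> n; apply: contrapT => Hn; apply: H; exists n => k.
  apply: contrapT => Hk; apply: Hn; exists k => c Cc.
  by apply: contrapT => Hc; apply: Hk; exists c.
have [N [m [p [Cp pP]]]] := Ttb ks; apply: nJS.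
pose F i := [set x | exists2 n, (n < N)%N & (S `&` T n (ks n) (p i)) x].
have JF : J [set x | exists2 i, (i < m)%N & F i x].
  by apply: JbigU => i _; apply: JbigU => n _; exact: ksP.
apply: Jsub (JU JC JF) _ => x Sx; have [Cx|] := EM (C x); last by left.
right; have [i li [n ln Tx]] := pP _ Cx.
by exists i => //; exists n.
Qed.

(* Otherwise finitely many translates of arbitrarily thin balls of radius [n]
   cover [C] modulo the ideal; since translations move points by a bounded
   amount, so does a single ball, around any centre, and [C] is bounded. *)
Lemma positive_off_ball S n : ~ J S ->
  exists k, forall c, C c -> ~ J (S `\` T n k c).
Proof.
move=> nJS; apply: contrapT => H.
have /choice [c cP] : forall k, exists c, C c /\ J (S `\` T n k c).
  move=> k; apply: contrapT => Hk; apply: H; exists k => c Cc JSc.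
  by apply: Hk; exists c.
have [m [g [Gg Jg]]] := Jcover nJS.
have /choice [d dP] : forall i, exists d, forall k x, C x -> T d k x (g i x).
  by move=> i; have [d dP] := Tdisp (Gg i); exists d.
have /choice [h hP] : forall i, exists h, G h /\ (cancel (g i) h /\ cancel h (g i)).
  by move=> i; have [h] := Ginv (Gg i); exists h.
pose M := maxn n (\max_(i < m) d i).
have one_ball j : exists2 a, C a & J (C `\` T M.+1 j a).
  have /choice [k kP] : forall i, exists k, (i < m)%N -> forall x y z,
      C x -> C y -> C z -> T (d i) k x y -> T n k y z -> T M.+1 j x z.
    move=> i; have [li|] := boolP (i < m)%N; last by exists 0%N.
    have dM : (d i <= M)%N.
      by rewrite leq_max; apply/orP; right; exact: (leq_bigmax (Ordinal li)).
    by have [k kP] := Tcomp j dM (leq_maxl n _); exists k => _.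
  pose K := (\max_(i < m) k i)%N.
  have [Cc JSc] := cP K; exists (c K) => //.
  pose F i := [set x | (S `\` T n K (c K)) (g i x)].
  have JF : J [set x | exists2 i, (i < m)%N & F i x].
    by apply: JbigU => i _; exact: Jtr.
  apply: Jsub (JU Jg JF) _ => x [Cx nTx].
  have [[i li Sx]|nx] := EM (translates g m S x); last by left.
  right; exists i => //; split=> // Tx; apply: nTx.
  have [Gh [_ gh]] := hP i.
  have kK : (k i <= K)%N by exact: (leq_bigmax (Ordinal li)).
  (* The inverse [h i] moves the centre [c K] by a distance of at most [d i], so all the translated
     balls lie in one ball around [c K]. *)
  apply: (kP i li _ (h i (c K))) => //; first exact: GC.
    by rewrite -{1}(gh (c K)); apply: Tsym; apply: dP; exact: GC.
  by rewrite -(TG _ _ _ _ (Gg i)) gh; exact: Tmon kK Tx.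
(* Balls of radius [M.+1] around centres that are far apart at radius [M.+2] have no common point in
   [C], yet each would cover [C] modulo [J]. *)
have [j0 [x [y [Cx Cy nT]]]] := Tunb M.+2.
have [j jP] := Tthin M.+1 j0; have [a Ca Ja] := one_ball j.
have all_ball z : C z -> J (C `\` T M.+1 j z).
  move=> Cz; have [f Gf fz] := Gtrans Cz Ca.
  apply: Jsub (Jtr Gf Ja) _ => w [Cw nTw]; split; first exact: GC.
  by rewrite -fz TG.
apply: JnC; apply: Jsub (JU (all_ball _ Cx) (all_ball _ Cy)) _ => z Cz.
have [Txz|] := EM (T M.+1 j x z); last by left.
right; split=> // Tyz; apply: nT; apply: (jP x z y) => //; exact: Tsym.
Qed.

(** Part of [S1] lies in a ball and part of [S2] outside a larger concentric ball. The uniformity of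
    [positive_off_ball] in the centre is essential: [k2] comes first, then [k], and only then the
    centre [c]. *)
Lemma positive_far S1 S2 n : ~ J S1 -> ~ J S2 ->
  exists n1 k1 n2 k2 c, [/\ C c, ~ J (S1 `&` T n1 k1 c),
    ~ J (S2 `\` T n2 k2 c) &
    exists k, forall x y, C x -> C y -> T n1 k1 c x -> ~ T n2 k2 c y ->
      ~ T n k x y].
Proof.
move=> nJ1 nJ2; have [n1 n1P] := positive_ball nJ1.
have [k2 k2P] := positive_off_ball (maxn n1 n).+1 nJ2.
have [k kP] := Tcomp k2 (leq_maxl n1 n) (leq_maxr n1 n).
have [c Cc nJc] := n1P k.
exists n1, k, (maxn n1 n).+1, k2, c; split=> //; first exact: k2P.
by exists k => x y Cx Cy Tcx nTcy Txy; apply: nTcy; exact: (kP c x y).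
Qed.

(** Finitely many translates of [S2] cover [C] modulo [J], hence also [S1]. *)
Lemma positive_recurrence S1 S2 : ~ J S1 -> ~ J S2 ->
  exists2 g, G g & ~ J (S1 `&` [set x | S2 (g x)]).
Proof.
move=> nJ1 nJ2; have [m [g [Gg Jg]]] := Jcover nJ2.
apply: contrapT => H; apply: nJ1.
pose F i := S1 `&` [set x | S2 (g i x)].
have JF : J [set x | exists2 i, (i < m)%N & F i x].
  by apply: JbigU => i _; apply: contrapT => n; apply: H; exists (g i).
apply: Jsub (JU (JU Jg JC) JF) _ => x S1x.
have [Cx|nCx] := EM (C x); last by left; right.
have [[i li Sx]|nx] := EM (translates g m S2 x); last by left; left.
by right; exists i.
Qed.

Lemma positive_dichotomy S R : ~ J S -> ~ J (S `&` R) \/ ~ J (S `\` R).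
Proof.
move=> nJS; apply: contrapT => /not_orP [/contrapT J1 /contrapT J2].
apply: nJS; apply: Jsub (JU J1 J2) _ => x Sx.
by have [Rx|nRx] := EM (R x); [left|right].
Qed.

End Positive.
End InvariantIdeal.

(** * Baire category for a family of conditions *)

(** Three arguments are what [countable_subfamily] needs: two sets that determine a translation, and
    a set to be translated. *)
Lemma countable_closure (I T : Type) (Q : set T) (F : I -> T -> T -> T -> T)
    (x0 : T) :
  countable [set: I] -> Q x0 -> (forall i x y z, Q x -> Q y -> Q z -> Q (F i x y z)) ->
  exists P : set T, [/\ P `<=` Q, P x0, countable P &
    forall i x y z, P x -> P y -> P z -> P (F i x y z)].
Proof.
move=> cI Qx0 QF.
pose step (P : set T) := P `|`
  (fun t => F t.1.1.1 t.1.1.2 t.1.2 t.2) @` ([set: I] `*` P `*` P `*` P).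
pose Ps n := iter n step [set x0].
have Pmon m n : (m <= n)%N -> Ps m `<=` Ps n.
  by move=> /subnK <-; elim: (n - m)%N => // k IH x /IH; left.
exists (\bigcup_n Ps n); split.
- move=> x [n _]; elim: n x => [x ->//|n IH] x [/IH //|[[[[i a] b] c]]].
  by move=> [[[_ /= /IH Qa] /= /IH Qb] /= /IH Qc] <-; exact: QF.
- by exists 0%N.
- apply: bigcup_countable => // n _; elim: n => [|n IH]; first exact: countable1.
  rewrite /Ps iterS -/(Ps n) /step -bigcup2inE; apply: bigcup_countable => //.
  move=> [|[|]] //= _; apply: sub_countable (card_image_le _ _) _.
  by rewrite -/(Ps n); do 3!apply: countableX => //; exact: IH.
- move=> i x y z [a _ Px] [b _ Py] [c _ Pz].
  exists (maxn a (maxn b c)).+1 => //; right; exists (i, x, y, z) => //=.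
  split; [split; [split=> //=|]|] => /=; [apply: Pmon Px|apply: Pmon Py|apply: Pmon Pz];
    by rewrite ?leq_max ?leqnn ?orbT.
Qed.

(* The properties of [Q] needed for the category argument are witnessed by
   countably many operations, so they pass to a countable subfamily. *)
Lemma countable_subfamily (Om : Type) (X C : set Om) (G : set (Om -> Om))
    (T : nat -> nat -> Om -> Om -> Prop) (Q : set (set Om))
    (W psi : nat -> set Om) (S0 : set Om) :
  Q S0 ->
  (forall j S, Q S ->
     exists2 S', Q S' & S' `<=` S /\ X `&` S' `<=` W j) ->
  (forall S R, Q S -> Q R \/ (exists i, R = psi i) ->
     exists2 S', Q S' & S' `<=` S /\ (S' `<=` R \/ S' `&` R = set0)) ->
  (forall S1 S2 n, Q S1 -> Q S2 -> exists S1' S2' k,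
     [/\ Q S1', Q S2', S1' `<=` S1, S2' `<=` S2 &
       forall x y, C x -> C y -> S1' x -> S2' y -> ~ T n k x y]) ->
  (forall S1 S2, Q S1 -> Q S2 -> exists g h,
     [/\ G g, cancel g h /\ cancel h g, Q (S1 `&` [set x | S2 (g x)]) &
       forall R, Q R -> Q [set x | R (g x)] /\ Q [set x | R (h x)]]) ->
  exists P : set (set Om), P S0 /\ P `<=` Q /\ countable P /\
   [/\ forall j S, P S ->
        exists2 S', P S' & S' `<=` S /\ X `&` S' `<=` W j,
      forall S R, P S -> P R \/ (exists i, R = psi i) ->
        exists2 S', P S' & S' `<=` S /\ (S' `<=` R \/ S' `&` R = set0),
      forall S1 S2 n, P S1 -> P S2 -> exists S1' S2' k,
        [/\ P S1', P S2', S1' `<=` S1, S2' `<=` S2 &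
          forall x y, C x -> C y -> S1' x -> S2' y -> ~ T n k x y] &
      forall S1 S2, P S1 -> P S2 -> exists g h,
        [/\ G g, cancel g h /\ cancel h g, P (S1 `&` [set x | S2 (g x)]) &
          forall R, P R -> P [set x | R (g x)] /\ P [set x | R (h x)]]].
Proof.
move=> QS0 Qopen Qdec Qfar Qrec.
have /choice [fo foP] : forall jS : nat * set Om, exists S', Q jS.2 ->
    [/\ Q S', S' `<=` jS.2 & X `&` S' `<=` W jS.1].
  move=> [j S]; have [/(Qopen j) [S' ? [? ?]]|nS] := EM (Q S).
    by exists S'.
  by exists S.
have /choice [fd fdP] : forall SR : set Om * set Om, exists S', Q SR.1 ->
    Q SR.2 \/ (exists i, SR.2 = psi i) ->
    [/\ Q S', S' `<=` SR.1 & S' `<=` SR.2 \/ S' `&` SR.2 = set0].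
  move=> [S R]; have [QS|nS] := EM (Q S); last by exists S.
  have [QR|nR] := EM (Q R \/ exists i, R = psi i); last by exists S.
  by have [S' ? [? ?]] := Qdec S R QS QR; exists S'.
have /choice [ff ffP] : forall p : nat * (set Om * set Om),
    exists r : set Om * set Om * nat, Q p.2.1 -> Q p.2.2 ->
    [/\ Q r.1.1, Q r.1.2, r.1.1 `<=` p.2.1, r.1.2 `<=` p.2.2 &
      forall x y, C x -> C y -> r.1.1 x -> r.1.2 y -> ~ T p.1 r.2 x y].
  move=> [n [S R]]; have [QS|nS] := EM (Q S); last by exists (S, S, 0%N).
  have [QR|nR] := EM (Q R); last by exists (S, S, 0%N).
  by have [S' [R' [k ?]]] := Qfar S R n QS QR; exists (S', R', k).
have /choice [fr frP] : forall p : set Om * set Om,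
    exists r : (Om -> Om) * (Om -> Om), Q p.1 -> Q p.2 ->
    [/\ G r.1, cancel r.1 r.2 /\ cancel r.2 r.1,
      Q (p.1 `&` [set x | p.2 (r.1 x)]) &
      forall R, Q R -> Q [set x | R (r.1 x)] /\ Q [set x | R (r.2 x)]].
  move=> [S R]; have [QS|nS] := EM (Q S); last by exists (id, id).
  have [QR|nR] := EM (Q R); last by exists (id, id).
  by have [g [h ?]] := Qrec S R QS QR; exists (g, h).
pose F (i : nat * nat) (S1 S2 R : set Om) : set Om :=
  match i.1 with
  | 0 => fo (i.2, S1)
  | 1 => fd (S1, S2)
  | 2 => fd (S1, psi i.2)
  | 3 => (ff (i.2, (S1, S2))).1.1
  | 4 => (ff (i.2, (S1, S2))).1.2
  | 5 => S1 `&` [set x | S2 ((fr (S1, S2)).1 x)]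
  | 6 => [set x | R ((fr (S1, S2)).1 x)]
  | _ => [set x | R ((fr (S1, S2)).2 x)]
  end%N.
have [|P [PQ PS0 cP PF]] :=
    @countable_closure _ _ Q F S0 (countableP [set: nat * nat]) QS0.
  move=> [i j] S1 S2 R Q1 Q2 QR; rewrite /F /=.
  have [? _ _] := foP (j, S1) Q1; have [? _ _] := fdP (S1, S2) Q1 (or_introl Q2).
  have [? _ _] := fdP (S1, psi j) Q1 (or_intror (ex_intro _ j erefl)).
  have [? ? _ _ _] := ffP (j, (S1, S2)) Q1 Q2.
  have [_ _ ? /(_ R QR) [? ?]] := frP (S1, S2) Q1 Q2.
  by move: i => [|[|[|[|[|[|[|i]]]]]]].
exists P; split=> //; split=> //; split=> //; split.
- move=> j S PS; exists (fo (j, S)); first exact: (PF (0, j)%N S S S).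
  by have [_ ? ?] := foP (j, S) (PQ _ PS).
- move=> S R PS [PR|[i ->]].
    exists (fd (S, R)); first exact: (PF (1, 0)%N S R R).
    by have [_ ? ?] := fdP (S, R) (PQ _ PS) (or_introl (PQ _ PR)).
  exists (fd (S, psi i)); first exact: (PF (2, i)%N S S S).
  by have [_ ? ?] := fdP (S, psi i) (PQ _ PS) (or_intror (ex_intro _ i erefl)).
- move=> S R n PS PR; have [_ _ ? ? far] := ffP (n, (S, R)) (PQ _ PS) (PQ _ PR).
  exists (ff (n, (S, R))).1.1, (ff (n, (S, R))).1.2, (ff (n, (S, R))).2.
  by split=> //; [exact: (PF (3, n)%N S R R)|exact: (PF (4, n)%N S R R)].
- move=> S1 S2 P1 P2; have [Gg gh _ _] := frP (S1, S2) (PQ _ P1) (PQ _ P2).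
  exists (fr (S1, S2)).1, (fr (S1, S2)).2; split=> //.
    exact: (PF (5, 0)%N S1 S2 S2).
  by move=> R PR; split; [exact: (PF (6, 0)%N S1 S2 R)|
    exact: (PF (7, 0)%N S1 S2 R)].
Qed.

Section Category.
Context (Om : Type) (X : set Om) (P : set (set Om)).
Hypothesis cP : countable P.

(** The members of [P] act as basic open sets, but only points of [X] are tested, because limits of
    conditions are found there. *)
Definition nowhere_dense (A : set Om) := forall S, P S ->
  exists2 S', P S' & S' `<=` S /\ forall x, X x -> S' x -> ~ A x.

Definition meager (A : set Om) := exists2 F : nat -> set Om,
  (forall i, nowhere_dense (F i)) & forall x, X x -> A x -> exists i, F i x.

(** A form of the Baire property relative to [P]. *)
Definition decided (A : set Om) := forall S, P S ->
  exists2 S', P S' & S' `<=` S /\ (meager (S' `&` A) \/ meager (S' `\` A)).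

Lemma meager_sub (A B : set Om) :
  (forall x, X x -> A x -> B x) -> meager B -> meager A.
Proof. by move=> AB [F nF BF]; exists F => // x Xx /AB /BF; exact. Qed.

Lemma nowhere_dense0 : nowhere_dense set0.
Proof. by move=> S PS; exists S => //; split=> [x|x _ _ []]. Qed.

Lemma meager0 : meager set0.
Proof. by exists (fun=> set0) => // _; exact: nowhere_dense0. Qed.

Lemma meager_nowhere_dense (A : set Om) : nowhere_dense A -> meager A.
Proof. by move=> nA; exists (fun=> A) => // x _ Ax; exists 0%N. Qed.

Lemma meager_bigcup (A : nat -> set Om) :
  (forall n, meager (A n)) -> meager [set x | exists n, A n x].
Proof.
move=> mA; have /choice [F FP] : forall n, exists F : nat -> set Om,
    (forall i, nowhere_dense (F i)) /\
    forall x, X x -> A n x -> exists i, F i x.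
  by move=> n; have [F ? ?] := mA n; exists F.
exists (fun i => if unpickle i is Some (n, m) then F n m else set0).
  move=> i; case: unpickle => [[n m]|]; first exact: (FP n).1.
  exact: nowhere_dense0.
move=> x Xx [n /((FP n).2 _ Xx) [m Fx]].
by exists (pickle (n, m)); rewrite pickleK.
Qed.

Lemma meagerU (A B : set Om) : meager A -> meager B -> meager (A `|` B).
Proof.
move=> mA mB; apply: (@meager_sub _ [set x | exists n,
    (if n is 0%N then A else B) x]).
  by move=> x _ [Ax|Bx]; [exists 0%N|exists 1%N].
by apply: meager_bigcup => -[|n].
Qed.

(* Banach's category theorem; countability of [P] makes it immediate. *)
Lemma meager_locally (A : set Om) :
  (forall S, P S -> exists2 S', P S' & S' `<=` S /\ meager (S' `&` A)) ->
  meager A.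
Proof.
move=> HA; have /countable_injP [c ci] := cP.
pose K n := [set x | exists S, [/\ P S, c S = n, meager (S `&` A) &
  (S `&` A) x]].
pose R := [set x | forall S, P S -> meager (S `&` A) -> ~ S x].
have mR : meager R.
  apply: meager_nowhere_dense => S PS; have [S' PS' [SS mS]] := HA S PS.
  by exists S' => //; split=> // x _ S'x Rx; exact: (Rx S' PS' mS S'x).
have mK n : meager (K n).
  have [[S [PS cS mS]]|nS] :=
      EM (exists S, [/\ P S, c S = n & meager (S `&` A)]).
    apply: meager_sub mS => x _ [S' [PS' cS' _]].
    by rewrite (ci S' S) ?inE // cS.
  by apply: meager_sub meager0 => x _ [S [PS cS mS _]]; case: nS; exists S.
apply: meager_sub (meagerU mR (meager_bigcup mK)) => x Xx Ax.
have [[S [PS mS Sx]]|nx] := EM (exists S, [/\ P S, meager (S `&` A) & S x]).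
  by right; exists (c S), S.
by left => S PS mS Sx; apply: nx; exists S.
Qed.

Lemma decidedC (A : set Om) : decided A -> decided (~` A).
Proof.
move=> dA S PS; have [S' PS' [SS H]] := dA S PS; exists S' => //.
split=> //; case: H => H; [right|left] => //.
by apply: meager_sub H => x _ [Sx /contrapT].
Qed.

Lemma decided_ext_meager (A B : set Om) :
  meager [set x | ~ (A x <-> B x)] -> decided A -> decided B.
Proof.
move=> mAB dA S PS; have [S' PS' [SS H]] := dA S PS; exists S' => //.
split=> //; case: H => H; [left|right];
  apply: meager_sub (meagerU mAB H) => x _ [Sx Bx];
  have [[AB BA]|] := EM (A x <-> B x); by [right; split=> //; auto|left].
Qed.

Hypothesis Pdec : forall S R, P S -> P R ->
  exists2 S', P S' & S' `<=` S /\ (S' `<=` R \/ S' `&` R = set0).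

(** If no [A n] is comeager on a condition below [S], then every [A n] is locally meager below [S].
    [Pdec] shrinks an arbitrary condition so that it lies inside [S] or is disjoint from it. *)
Lemma decided_bigcup (A : nat -> set Om) :
  (forall n, decided (A n)) -> decided [set x | exists n, A n x].
Proof.
move=> dA S PS.
have [[n [S' [PS' SS mS]]]|H] := EM (exists n S',
    [/\ P S', S' `<=` S & meager (S' `\` A n)]).
  exists S' => //; split=> //; right; apply: meager_sub mS => x _ [Sx nx].
  by split=> // Ax; apply: nx; exists n.
exists S => //; split=> //; left.
apply: (@meager_sub _ [set x | exists n, (S `&` A n) x]).
  by move=> x _ [Sx [n Ax]]; exists n.
apply: meager_bigcup => n; apply: meager_locally => R PR.
have [R' PR' [RR [RS|RS]]] := Pdec PR PS; last first.
  exists R' => //; split=> //; apply: meager_sub meager0 => x _ [Rx [Sx _]].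
  by rewrite -RS.
have [R'' PR'' [RR' [mR|mR]]] := dA n _ PR'.
  exists R'' => //; split; first exact: subset_trans RR.
  by apply: meager_sub mR => x _ [? [_ ?]].
by case: H; exists n, R''; split=> // x /RR' /RS.
Qed.

Lemma decided_basic (A : set Om) :
  (forall S, P S -> exists2 S', P S' &
     S' `<=` S /\ (S' `<=` A \/ S' `&` A = set0)) -> decided A.
Proof.
move=> H S PS; have [S' PS' [SS [SA|SA]]] := H S PS; exists S' => //; split=> //.
  by right; apply: meager_sub meager0 => x _ [/SA].
by left; rewrite SA; exact: meager0.
Qed.

(** * Generic pairs *)

Section Generic.
Context (C : set Om) (G : set (Om -> Om)) (T : nat -> nat -> Om -> Om -> Prop).
Hypotheses
  (GC : forall g x, G g -> C x -> C (g x))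
  (Tdisp : forall g, G g -> exists n, forall k x, C x -> T n k x (g x))
  (PC : forall S, P S -> exists2 x, C x & S x)
  (Pfar : forall S1 S2 n, P S1 -> P S2 -> exists S1' S2' k,
     [/\ P S1', P S2', S1' `<=` S1, S2' `<=` S2 &
       forall x y, C x -> C y -> S1' x -> S2' y -> ~ T n k x y])
  (Prec : forall S1 S2, P S1 -> P S2 -> exists g h,
     [/\ G g, cancel g h /\ cancel h g, P (S1 `&` [set x | S2 (g x)]) &
       forall R, P R -> P [set x | R (g x)] /\ P [set x | R (h x)]])
  (Plim_near : forall (S S' : nat -> set Om) m,
     (forall n, P (S n)) -> (forall n, P (S' n)) ->
     (forall n, S n.+1 `<=` S n) -> (forall n, S' n.+1 `<=` S' n) ->
     (forall n k, exists x y, [/\ C x, C y, S n x, S' n y & T m k x y]) ->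
     exists x y, [/\ X x, X y, forall n, S n x, forall n, S' n y &
       forall k, T m k x y])
  (Plim_far : forall (S S' : nat -> set Om) (ks : nat -> nat),
     (forall n, P (S n)) -> (forall n, P (S' n)) ->
     (forall n, S n.+1 `<=` S n) -> (forall n, S' n.+1 `<=` S' n) ->
     (forall n, exists x y, [/\ C x, C y, S n x, S' n y &
        forall i, (i < n)%N -> ~ T i (ks i) x y]) ->
     exists x y, [/\ X x, X y, forall n, S n x, forall n, S' n y &
       forall i, ~ T i (ks i) x y]).

(** A decreasing sequence of conditions and its image under [g] avoid the two meager sets step by
    step. The limit pair need not be of the form [x], [g x], since the displacement of [g] is
    bounded on [C] only; the pairs [c], [g c] with [c] in [C] serve as approximations. *)
Lemma generic_ergodic (A B : set Om) S1 S2 : P S1 -> P S2 ->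
  (forall x y m, X x -> X y -> A x -> B y -> ~ forall k, T m k x y) ->
  meager (S1 `\` A) -> meager (S2 `\` B) -> False.
Proof.
move=> PS1 PS2 AB [F nF HF] [F' nF' HF'].
have [g [h [Gg [gh hg] PS3 Ptr]]] := Prec PS1 PS2.
have /choice [nx nxP] : forall nR : nat * set Om, exists R', P nR.2 ->
    [/\ P R', R' `<=` nR.2, forall x, X x -> R' x -> ~ F nR.1 x &
      forall y, X y -> R' (h y) -> ~ F' nR.1 y].
  move=> [n R]; have [PR|nPR] := EM (P R); last by exists R.
  have [R1 PR1 [RR1 FR1]] := nF n R PR.
  have [R2 PR2 [RR2 FR2]] := nF' n _ (Ptr _ PR1).2.
  exists [set x | R2 (g x)] => _; split.
  - exact: (Ptr _ PR2).1.
  - by move=> x /RR2 /=; rewrite gh => /RR1.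
  - by move=> x Xx /RR2 /=; rewrite gh; exact: FR1.
  - by move=> y Xy /=; rewrite hg; exact: FR2.
pose S3 := S1 `&` [set x | S2 (g x)].
pose fix Rs n := if n is m.+1 then nx (m, Rs m) else S3.
have PRs n : P (Rs n) by elim: n => // n IH; have [] := nxP (n, Rs n) IH.
have [m mP] := Tdisp Gg.
have [|||||x [y [Xx Xy Rx Ry Txy]]] :=
    @Plim_near Rs (fun n => [set y | Rs n (h y)]) m.
- by [].
- by move=> n; exact: (Ptr _ (PRs n)).2.
- by move=> n; have [] := nxP (n, Rs n) (PRs n).
- by move=> n y /=; have [_ H _ _] := nxP (n, Rs n) (PRs n); exact: H.
- move=> n k; have [c Cc Rc] := PC (PRs n); exists c, (g c).
  by split=> //=; [exact: GC|rewrite gh|exact: mP].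
have [S1x _] := Rx 0%N; have [_] := Ry 0%N; rewrite /= hg => S2y.
apply: (AB x y m) => //; apply: contrapT => n.
  have [i Fx] := HF _ Xx (conj S1x n).
  by have [_ _ H _] := nxP (i, Rs i) (PRs i); exact: H Xx (Rx i.+1) Fx.
have [i Fy] := HF' _ Xy (conj S2y n).
by have [_ _ _ H] := nxP (i, Rs i) (PRs i); exact: H Xy (Ry i.+1) Fy.
Qed.

(** Two sequences of conditions are refined together. Step [n] separates them at radius [n], so in
    the limit every radius is excluded. *)
Lemma generic_pair (A : set Om) S0 : P S0 -> meager A ->
  exists x y, [/\ X x, X y, ~ A x, ~ A y & forall n, exists k, ~ T n k x y].
Proof.
move=> PS0 [F nF HF].
have /choice [nx nxP] : forall nR : nat * (set Om * set Om),
    exists r : set Om * set Om * nat, P nR.2.1 -> P nR.2.2 ->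
    [/\ P r.1.1 /\ P r.1.2, r.1.1 `<=` nR.2.1 /\ r.1.2 `<=` nR.2.2,
      forall x, X x -> r.1.1 x \/ r.1.2 x -> ~ F nR.1 x &
      forall x y, C x -> C y -> r.1.1 x -> r.1.2 y -> ~ T nR.1 r.2 x y].
  move=> [n [S S']]; have [PS|nPS] := EM (P S); last by exists (S, S', 0%N).
  have [PS'|nPS'] := EM (P S'); last by exists (S, S', 0%N).
  have [S1 [S2 [k [P1 P2 SS1 SS2 far]]]] := Pfar n PS PS'.
  have [R1 PR1 [RS1 FR1]] := nF n _ P1; have [R2 PR2 [RS2 FR2]] := nF n _ P2.
  exists (R1, R2, k) => _ _; split=> /=.
  - by [].
  - by split; [apply: subset_trans SS1|apply: subset_trans SS2].
  - by move=> x Xx [Rx|Rx]; [exact: FR1|exact: FR2].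
  - by move=> x y Cx Cy /RS1 ? /RS2 ?; exact: far.
pose fix st n := if n is m.+1 then (nx (m, st m)).1 else (S0, S0).
have Pst n : P (st n).1 /\ P (st n).2.
  by elim: n => //= n [IH IH']; have [] := nxP (n, st n) IH IH'.
have stP n := nxP (n, st n) (Pst n).1 (Pst n).2.
have mon1 i n : (i <= n)%N -> (st n).1 `<=` (st i).1.
  move=> /subnK <-; elim: (n - i)%N => // k IH x; rewrite addSn => Sx.
  by apply: IH; have [_ [H _] _ _] := stP (k + i)%N; exact: H.
have mon2 i n : (i <= n)%N -> (st n).2 `<=` (st i).2.
  move=> /subnK <-; elim: (n - i)%N => // k IH x; rewrite addSn => Sx.
  by apply: IH; have [_ [_ H] _ _] := stP (k + i)%N; exact: H.
have [|||||x [y [Xx Xy Sx Sy far]]] := @Plim_far (fun n => (st n).1)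
  (fun n => (st n).2) (fun n => (nx (n, st n)).2).
- by move=> n; exact: (Pst n).1.
- by move=> n; exact: (Pst n).2.
- by move=> n; exact: mon1.
- by move=> n; exact: mon2.
- move=> n; have [c Cc Sc] := PC (Pst n).1; have [d Cd Sd] := PC (Pst n).2.
  exists c, d; split=> // i li; have [_ _ _ H] := stP i.
  by apply: H => //; [exact: mon1 li _ _|exact: mon2 li _ _].
exists x, y; split=> //.
- move=> Ax; have [i Fx] := HF _ Xx Ax; have [_ _ H _] := stP i.
  by apply: H Fx => //; left; exact: (Sx i.+1).
- move=> Ay; have [i Fy] := HF _ Xy Ay; have [_ _ H _] := stP i.
  by apply: H Fy => //; right; exact: (Sy i.+1).
- by move=> n; exists (nx (n, st n)).2; exact: far.
Qed.

(* By ergodicity each [A i] is meager or comeager relative to [Y]. *)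
Lemma generic_pair_undistinguished (Y : set Om) (A : nat -> set Om) S0 :
  P S0 -> meager (~` Y) -> (forall i, A i `<=` Y) ->
  (forall i, decided (A i)) ->
  (forall i x y m, X x -> X y -> A i x -> Y y -> (forall k, T m k x y) ->
     A i y) ->
  exists x y, [/\ X x /\ Y x, X y /\ Y y, forall i, A i x <-> A i y &
    forall n, exists k, ~ T n k x y].
Proof.
move=> PS0 mY AY dA Ainv.
have mA i : meager (A i) \/ meager (Y `\` A i).
  have [[S1 [PS1 mS1]]|nS1] := EM (exists S1, P S1 /\ meager (S1 `\` A i)).
    right; apply: meager_locally => S PS; have [S' PS' [SS [mS|mS]]] := dA i S PS.
      exfalso; apply: (@generic_ergodic (A i) (Y `\` A i) S1 S') => //.
        by move=> x y m Xx Xy Ax [Yy nAy] Txy; apply: nAy; exact: Ainv Txy.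
      apply: meager_sub (meagerU mY mS) => x _ [Sx nx].
      have [Yx|nYx] := EM (Y x); last by left.
      by right; split=> //; apply: contrapT => nAx; apply: nx.
    exists S' => //; split=> //; apply: meager_sub mS => x _ [Sx [_ nAx]].
    by [].
  left; apply: meager_locally => S PS; have [S' PS' [SS [mS|mS]]] := dA i S PS.
    by exists S'.
  by case: nS1; exists S'.
(* For a point of [Y] outside [Bad], membership in [A i] depends only on whether [A i] is meager. *)
pose Bad := [set x | exists i,
  if pselect (meager (A i)) then A i x else (Y `\` A i) x].
have mBad : meager Bad.
  apply: meager_bigcup => i; case: pselect => // nA.
  by case: (mA i) => // /nA.
have [x [y [Xx Xy nx ny far]]] := generic_pair PS0 (meagerU mY mBad).
have in_Y z : ~ (~` Y `|` Bad) z -> Y z.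
  by move=> nz; apply: contrapT => nYz; apply: nz; left.
have AE z i : ~ (~` Y `|` Bad) z -> (A i z <-> ~ meager (A i)).
  move=> nz; have Yz := in_Y z nz.
  split=> [Az mAi|nm]; apply: contrapT => H; apply: nz; right; exists i;
    case: pselect => // mAi'; by case: H.
exists x, y; split=> //; [by split=> //; exact: in_Y|by split=> //; exact: in_Y|].
by move=> i; rewrite AE // AE.
Qed.

End Generic.
End Category.

(** * Borel sets of types *)

Lemma open_stone_subbase (L : language) (D : Type) (N : structure L D)
    (V : Type) (B : set D) (O : set (stone N V B)) (p : stone N V B) :
  open O -> O p -> exists E : seq (set (stone N V B)),
    [/\ forall i, i \in E -> range (@stone_basic L D N V B) i,
        forall i, i \in E -> i p &
        forall q, (forall i, i \in E -> i q) -> O q].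
Proof.
move=> [Fs FsE <-] [I FsI Ip].
have [E EB EI] : finI_from (range (@stone_basic L D N V B)) id I := FsE _ FsI.
exists (finmap.enum_fset E); split.
- by move=> i iE; exact: set_mem (EB i iE).
- have {}Ip : I p := Ip.
  by rewrite -EI in Ip.
- move=> q qE; have Iq : I q by rewrite -EI => i iE; exact: qE.
  by exists I.
Qed.

Lemma open_stone (L : language) (D : Type) (N : structure L D) (V : Type)
    (B : set D) (O : set (stone N V B)) (x : V -> D) :
  open O -> O (tp N B x) ->
  exists S, [/\ definable N B S, S x & forall y, S y -> O (tp N B y)].
Proof.
move=> oO Ox; have [E [EB Ex EO]] := open_stone_subbase oO Ox.
suff [S [dS Sx SE]] : exists S, [/\ definable N B S, S x &
    forall y, S y -> forall i : set (stone N V B),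
      i \in E -> i (tp N B y)].
  by exists S; split=> // y Sy; apply: EO => i iE; exact: (SE y Sy i iE).
move: E EB Ex {EO} => s; elim: s => [|i s IH] sB sx.
  by exists setT; split=> //; exact: definableT.
have [||S [dS Sx SE]] := IH.
- by move=> j js; apply: sB; rewrite inE js orbT.
- by move=> j js; apply: sx; rewrite inE js orbT.
have [phi _ phi_i] := sB i (mem_head _ _).
exists (S `&` [set y | sat N phi (with_params y)]); split.
- by apply: definableI => //; exists phi.
- by split=> //; have := sx i (mem_head _ _); rewrite -phi_i.
- move=> y [Sy phiy] j; rewrite inE => /orP [/eqP ->|]; last exact: SE.
  by rewrite -phi_i.
Qed.

Lemma open_cantor_bit i b : open [set z : cantor_space | z i = b].
Proof.
rewrite -[X in open X]/((@proj nat (fun=> bool) i) @^-1` [set b]).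
apply: open_comp; last exact: discrete_open.
by move=> z _; exact: proj_continuous.
Qed.

Section Enumeration.
Context (L : language) (D : Type) (N : structure L D).
Hypothesis cL : countable_language L.

Lemma definable_enumeration (V : Type) (B : set D) :
  countable [set: V] -> countable B -> exists psi : nat -> set (V -> D),
    (forall i, definable N B (psi i)) /\
    forall S, definable N B S -> exists i, psi i = S.
Proof.
move=> cV cB; have /countable_injP [c ci] :=
  countable_formula cL (countable_sum cV (countable_set_type cB)).
have {}ci phi psi : c phi = c psi -> phi = psi by apply: ci; exact: in_setT.
have /choice [f fP] : forall i, exists phi : formula L (V + B),
    forall psi, c psi = i -> psi = phi.
  move=> i; have [[phi cphi]|n] := EM (exists phi, c phi = i).
    by exists phi => psi cpsi; apply: ci; rewrite cpsi cphi.
  by exists Bot => psi cpsi; case: n; exists psi.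
exists (fun i => [set a | sat N (f i) (with_params a)]); split.
  by move=> i; exists (f i).
by move=> S [phi ->]; exists (c phi); rewrite -(fP _ phi).
Qed.

Lemma type_definable_sequence (V : Type) (B : set D) (Z : set (V -> D)) :
  countable [set: V] -> countable B -> type_definable N B Z ->
  exists th : nat -> set (V -> D), [/\ forall k, definable N B (th k),
    forall k, th k.+1 `<=` th k & Z = \bigcap_k th k].
Proof.
move=> cV cB /type_definableP ZP.
have [psi [dpsi psiP]] := definable_enumeration cV cB.
pose F i := if pselect (Z `<=` psi i) then psi i else setT.
have dF i : definable N B (F i).
  by rewrite /F; case: pselect => /= ?; [exact: dpsi|exact: definableT].
exists (fun k => [set a | forall i, (i < k)%N -> F i a]); split.
- by move=> k; exact: definable_bigI.
- by move=> k a Fa i li; apply: Fa; exact: leqW.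
- apply/seteqP; split=> [a Za k _ i _|a Fa].
    by rewrite /F; case: pselect => // ZF; exact: ZF.
  apply: ZP => S dS ZS; have [i iS] := psiP S dS.
  by have := Fa i.+1 I i (ltnSn i); rewrite /F iS; case: pselect.
Qed.

End Enumeration.

(** * The uniformity of a normal form *)

Section Thickening.
Context (L : language) (D : Type) (N : structure L D) (V : Type).

(** [U n] is thought of as distance at most [n], and the [T n k] as its basic neighbourhoods,
    shrinking as [k] grows. *)
Definition thickening (U : nat -> set ((V -> D) * (V -> D)))
    (T : nat -> nat -> (V -> D) -> (V -> D) -> Prop) :=
  [/\ forall n k, definable N set0
        [set w : V + V -> D | T n k (w \o inl) (w \o inr)],
      forall n k x y, T n k.+1 x y -> T n k x y,
      forall n k x y, T n k x y -> T n k y x &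
      forall n x y, U n (x, y) <-> forall k, T n k x y].

Lemma thickening_exists (U : nat -> set ((V -> D) * (V -> D))) :
  countable_language L -> countable [set: V] ->
  (forall n, type_definable N set0 (rel_set (U n))) ->
  (forall n a b, U n (a, b) -> U n (b, a)) ->
  exists T, thickening U T.
Proof.
move=> cL cV tU Usym.
have cVV : countable [set: V + V] by exact: countable_sum.
have /choice [th thP] := fun n => type_definable_sequence cL cVV
  (@countable0 D) (tU n).
(* Imposing both orders makes the approximations symmetric; the intersection is still [U n], which
   is symmetric itself. *)
exists (fun n k x y => th n k (join x y) /\ th n k (join y x)); split.
- move=> n k; have [dth _ _] := thP n.
  have E (w : V + V -> D) : join (w \o inl) (w \o inr) = w.
    by apply: funext => -[].
  have E' (w : V + V -> D) : join (w \o inr) (w \o inl) = w \o join inr inl.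
    by apply: funext => -[].
  rewrite [X in definable _ _ X](_ : _ = th n k `&`
    [set w : V + V -> D | th n k (w \o join inr inl)]).
    by apply: definableI => //; exact: definable_reindex.
  by apply/seteqP; split=> w /=; rewrite E E'.
- by move=> n k x y [xy yx]; have [_ H _] := thP n; split; exact: H.
- by move=> n k x y [].
- move=> n x y; have [_ _ UE] := thP n.
  have UEP a b : U n (a, b) <-> forall k, th n k (join a b).
    have -> : U n (a, b) = rel_set (U n) (join a b) by [].
    by rewrite UE; split=> [H k|H k _]; exact: H.
  split=> [Uxy k|H]; last by apply/UEP => k; exact: (H k).1.
  by split; [exact: (UEP x y).1|apply: (UEP y x).1; exact: Usym].
Qed.

End Thickening.

Section Uniformity.
Context (L : language) (kappa D : Type) (N : structure L D) (V : Type)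
  (A : set D) (X : set (V -> D)) (E : set ((V -> D) * (V -> D)))
  (U : nat -> set ((V -> D) * (V -> D)))
  (T : nat -> nat -> (V -> D) -> (V -> D) -> Prop).
Hypotheses (kbig : big kappa) (Nsat : saturated kappa N)
  (cV : countable [set: V]) (cA : countable A) (tX : type_definable N A X)
  (HU : normal_form N X E U) (HT : thickening N U T).

Let Tdef W (f g : V -> W) n k :
  definable N set0 [set w : W -> D | T n k (w \o f) (w \o g)].
Proof.
have [dT _ _ _] := HT.
exact: (definable_reindex (join f g) (dT n k)).
Qed.

Let Tdec n k x y : T n k.+1 x y -> T n k x y.
Proof. by have [_ H _ _] := HT; exact: H. Qed.

Let Tsym n k x y : T n k x y -> T n k y x.
Proof. by have [_ _ H _] := HT; exact: H. Qed.

Let TU n x y : U n (x, y) <-> forall k, T n k x y.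
Proof. by have [_ _ _ H] := HT. Qed.

Lemma thickening_automorphism s n k x y : automorphism N s ->
  T n k (s \o x) (s \o y) <-> T n k x y.
Proof.
move=> sA; have := definable0_automorphism (join x y) sA (Tdef inl inr n k).
by rewrite join_comp.
Qed.

Lemma thickening_refl n k x : X x -> T n k x x.
Proof.
move=> Xx; have [_ _ U0 _ Ucomp] := HU; apply/TU: k.
by elim: n => [|n IH]; [exact: U0|exact: (Ucomp n x x x)].
Qed.

Let tXW (W : Type) (B : set D) (f : V -> W) : A `<=` B ->
  type_definable N B [set w : W -> D | X (w \o f)].
Proof.
by move=> AB; apply: type_definable_sub AB _; exact: type_definable_reindex.
Qed.

Let tT W (f g : V -> W) (B : set D) n k :
  type_definable N B [set w : W -> D | T n k (w \o f) (w \o g)].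
Proof.
apply: type_definable_definable; apply: definable_sub (Tdef f g n k).
exact: sub0set.
Qed.

Let tTC W (f g : V -> W) (B : set D) n k :
  type_definable N B [set w : W -> D | ~ T n k (w \o f) (w \o g)].
Proof.
apply: type_definable_definable; apply: definableC.
by apply: definable_sub (Tdef f g n k); exact: sub0set.
Qed.

(** Otherwise compactness yields a triple in [X] that violates the composition axiom of the normal
    form. *)
Lemma thickening_comp n j : exists k, forall x y z, X x -> X y -> X z ->
  T n k x y -> T n k y z -> T n.+1 j x z.
Proof.
apply: contrapT => H.
pose i1 : V -> V + V + V := inl \o inl.
pose i2 : V -> V + V + V := inl \o inr.
pose i3 : V -> V + V + V := inr.
pose Z k := [set w : V + V + V -> D | X (w \o i1)] `&`
  [set w : V + V + V -> D | X (w \o i2)] `&` [set w : V + V + V -> D | X (w \o i3)] `&`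
  [set w : V + V + V -> D | T n k (w \o i1) (w \o i2)] `&`
  [set w : V + V + V -> D | T n k (w \o i2) (w \o i3)] `&`
  [set w : V + V + V -> D | ~ T n.+1 j (w \o i1) (w \o i3)].
have [||k|k w|k|w Zw] := @compactness _ _ N kappa _ A Z kbig Nsat.
- by do 2!apply: countable_sum => //.
- exact: countable_small.
- by do ![apply: type_definableI]; [exact: tXW|exact: tXW|exact: tXW|
    exact: tT|exact: tT|exact: tTC].
- by move=> [[[[[? ?] ?] /Tdec ?] /Tdec ?] ?].
- apply: contrapT => Zk; apply: H; exists k => x y z Xx Xy Xz Txy Tyz.
  by apply: contrapT => nT; apply: Zk; exists (join (join x y) z).
have [[[[[X1 X2] X3] _] _] nT] := Zw 0%N.
have [_ _ _ _ Ucomp] := HU; apply: nT; move: (j).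
by apply/TU; apply: (Ucomp _ _ _ (w \o i2)) => //; apply/TU => k;
  have [[[? ?] ?] _] := Zw k.
Qed.

Lemma ball_in_pseudo_open (W : set (V -> D)) a n : pseudo_open kappa N W ->
  (forall x, X x -> U n (a, x) -> W x) ->
  exists k, forall x, X x -> T n k a x -> W x.
Proof.
move=> [B sB tW] UW; apply: contrapT => H.
pose B' := B `|` (A `|` range a).
have sB' : small kappa B'.
  apply: small_setU_countable => //; rewrite -bigcup2inE.
  apply: bigcup_countable => // -[|[|]] //= _.
  exact: sub_countable (card_image_le _ _) cV.
have Ba k : definable N B' [set x | T n k a x].
  apply: definable_sub (definable_fix_left a (Tdef inl inr n k)) => y.
  by move=> [//|ya]; right; right.
pose Z k := [set x : V -> D | X (x \o id)] `&` [set x | T n k a x] `&` ~` W.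
have [k|k x|k|x Zx] := @compactness _ _ N kappa _ B' Z kbig Nsat cV sB'.
- apply: type_definableI; first apply: type_definableI.
  + by apply: tXW => y Ay; right; left.
  + exact: type_definable_definable.
  + by apply: type_definable_sub tW => y; left.
- by move=> [[? /Tdec ?] ?].
- apply: contrapT => Zk; apply: H; exists k => x Xx Tx.
  by apply: contrapT => nW; apply: Zk; exists x.
have [[Xx _] nW] := Zx 0%N; apply: nW; apply: UW => //.
by apply/TU => k; have [[]] := Zx k.
Qed.

Section Limits.
Context (C : set (V -> D)) (S S' : nat -> set (V -> D)).
Hypotheses (CX : C `<=` X)
  (dS : forall n, exists2 B, countable B & definable N B (S n))
  (dS' : forall n, exists2 B, countable B & definable N B (S' n))
  (Sdec : forall n, S n.+1 `<=` S n) (S'dec : forall n, S' n.+1 `<=` S' n).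

(** The approximating pairs lie in [C]; type definability of [X] is what lets the limit pair stay in
    [X]. *)
Let limit (R : nat -> set (V + V -> D)) :
  (forall n, definable N set0 (R n)) -> (forall n, R n.+1 `<=` R n) ->
  (forall n, exists x y, [/\ C x, C y, S n x, S' n y & R n (join x y)]) ->
  exists x y, [/\ X x, X y, forall n, S n x, forall n, S' n y &
    forall n, R n (join x y)].
Proof.
move=> dR Rdec ne.
have /choice [B BP] := fun n => let: ex_intro2 B cB dB := dS n in
  ex_intro (fun B => countable B /\ definable N B (S n)) B (conj cB dB).
have /choice [B' B'P] := fun n => let: ex_intro2 B cB dB := dS' n in
  ex_intro (fun B => countable B /\ definable N B (S' n)) B (conj cB dB).
pose K := A `|` (\bigcup_n B n `|` \bigcup_n B' n).
have cU (P Q : set D) : countable P -> countable Q -> countable (P `|` Q).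
  by move=> ? ?; rewrite -bigcup2inE; apply: bigcup_countable => // -[|[|]].
have cK : countable K.
  apply: (cU _ _ cA); apply: cU; apply: bigcup_countable => // n _.
    exact: (BP n).1.
  exact: (B'P n).1.
pose Z n := [set w : V + V -> D | X (w \o inl)] `&`
  [set w : V + V -> D | X (w \o inr)] `&`
  [set w : V + V -> D | S n (w \o inl)] `&`
  [set w : V + V -> D | S' n (w \o inr)] `&` R n.
have [||n|n w|n|w Zw] := @compactness _ _ N kappa _ K Z kbig Nsat.
- exact: countable_sum.
- exact: countable_small.
- apply: type_definableI; first apply: type_definableI;
    first apply: type_definableI; first apply: type_definableI.
  + by apply: tXW => y; left.
  + by apply: tXW => y; left.
  + apply: type_definable_definable; apply: definable_reindex.
    by apply: definable_sub (BP n).2 => y By; right; left; exists n.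
  + apply: type_definable_definable; apply: definable_reindex.
    by apply: definable_sub (B'P n).2 => y By; right; right; exists n.
  + apply: type_definable_definable; apply: definable_sub (dR n).
    exact: sub0set.
- by move=> [[[[? ?] /Sdec ?] /S'dec ?] /Rdec ?].
- have [x [y [/CX Xx /CX Xy Sx Sy Rxy]]] := ne n.
  by exists (join x y).
exists (w \o inl), (w \o inr).
have wE : join (w \o inl) (w \o inr) = w by apply: funext => -[].
by split=> [||n|n|n]; rewrite ?wE;
  [have := Zw 0%N|have := Zw 0%N|have := Zw n|have := Zw n|have := Zw n] => -[[[[]]]].
Qed.

Lemma limit_near m :
  (forall n k, exists x y, [/\ C x, C y, S n x, S' n y & T m k x y]) ->
  exists x y, [/\ X x, X y, forall n, S n x, forall n, S' n y &
    forall k, T m k x y].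
Proof.
move=> H; apply: (limit (R := fun k =>
    [set w : V + V -> D | T m k (w \o inl) (w \o inr)])).
- by move=> n; exact: Tdef.
- by move=> n w /Tdec.
- by move=> n; exact: H.
Qed.

Lemma limit_far (ks : nat -> nat) :
  (forall n, exists x y, [/\ C x, C y, S n x, S' n y &
     forall i, (i < n)%N -> ~ T i (ks i) x y]) ->
  exists x y, [/\ X x, X y, forall n, S n x, forall n, S' n y &
    forall i, ~ T i (ks i) x y].
Proof.
move=> H; have [|||x [y [Xx Xy Sx Sy far]]] := limit (R := fun n =>
    [set w : V + V -> D | forall i, (i < n)%N ->
       (~` [set w : V + V -> D | T i (ks i) (w \o inl) (w \o inr)]) w]).
- by move=> n; apply: definable_bigI => i; apply: definableC; exact: Tdef.
- by move=> n w Hw i li; apply: Hw; exact: leqW.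
- by move=> n; exact: H.
exists x, y; split=> // i; exact: (far i.+1 i).
Qed.

End Limits.

Section TotallyBounded.
Context (M : set D) (C : set (V -> D)).
Hypotheses (cL : countable_language L) (cM : countable M) (AM : A `<=` M)
  (CX : C `<=` X)
  (EM_type : forall a b, X a -> X b ->
     (forall S, definable N M S -> S a -> S b) -> E (a, b)).

(* Pairs in [X] with the same type over [M] lie in some [U n]; by compactness
   finitely many formulas over [M] suffice, and a point of [C] for each of
   their patterns gives the finite cover. *)
Lemma totally_bounded (ks : nat -> nat) : C !=set0 ->
  exists N0 m (p : nat -> V -> D),
    (forall i, C (p i)) /\ forall x, C x -> exists2 i, (i < m)%N &
      exists2 n, (n < N0)%N & T n (ks n) (p i) x.
Proof.
move=> [a0 Ca0]; apply: contrapT => H.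
have [psi [dpsi psiP]] := definable_enumeration N cL cV cM.
pose F i := [set w : V + V -> D | psi i (w \o inl)].
pose F' i := [set w : V + V -> D | psi i (w \o inr)].
pose Z k := [set w : V + V -> D | X (w \o inl)] `&`
  [set w : V + V -> D | X (w \o inr)] `&`
  [set w | forall i, (i < k)%N -> (F i `&` F' i `|` ~` F i `&` ~` F' i) w] `&`
  [set w | forall i, (i < k)%N ->
     (~` [set w : V + V -> D | T i (ks i) (w \o inl) (w \o inr)]) w].
have [||k|k w|k|w Zw] := @compactness _ _ N kappa _ M Z kbig Nsat.
- exact: countable_sum.
- exact: countable_small.
- apply: type_definableI; first apply: type_definableI;
    first apply: type_definableI; [exact: tXW|exact: tXW| |].
    apply: type_definable_definable; apply: definable_bigI => i.
    by apply: definableU; apply: definableI; do ?apply: definableC;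
      exact: definable_reindex.
  apply: type_definable_definable; apply: definable_bigI => i.
  apply: definableC; apply: definable_sub (Tdef inl inr i (ks i)).
  exact: sub0set.
- by move=> [[[? ?] H1] H2]; split; [split=> // i li; apply: H1|
    move=> i li; apply: H2]; exact: leqW.
- apply: contrapT => Zk; apply: H.
  pose pat x := [ffun i : 'I_k => `[< psi i x >]].
  have /choice [p pP] : forall t : {ffun 'I_k -> bool}, exists c,
      C c /\ forall x, C x -> pat x = t -> pat c = t.
    move=> t; have [[c [Cc ct]]|n] := EM (exists c, C c /\ pat c = t).
      by exists c.
    by exists a0; split=> // x Cx xt; case: n; exists x.
  pose ts := enum {ffun 'I_k -> bool}.
  exists k, (size ts), (fun i => p (nth [ffun=> false] ts i)).
  split=> [i|x Cx]; first exact: (pP _).1.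
  exists (index (pat x) ts); first by rewrite index_mem mem_enum.
  rewrite nth_index ?mem_enum //; apply: contrapT => nT; apply: Zk.
  have [Cp /(_ x Cx erefl) /ffunP pE] := pP (pat x).
  exists (join (p (pat x)) x); split; first split; first by split; exact: CX.
    move=> i li; have pxE := pE (Ordinal li); rewrite !ffunE /= in pxE.
    have E1 := asbool_eq_equiv pxE.
    have [px|npx] := EM (psi i x); first by left; split; [exact: (E1.2 px)|].
    by right; split=> [px|] //; apply: npx; exact: (E1.1 px).
  by move=> i li Ti; apply: nT; exists i.
have [[[X1 X2] _] _] := Zw 0%N.
have [_ EU _ _ _] := HU.
have : E (w \o inl, w \o inr).
  apply: EM_type => // S /psiP [i <-] Si; have [[_ H1] _] := Zw i.+1.
  by case: (H1 i (ltnSn i)) => -[].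
rewrite EU => -[n _ /TU Un]; have [_ H2] := Zw n.+1.
exact: H2 n (ltnSn n) (Un _).
Qed.

End TotallyBounded.
End Uniformity.

(** * The Baire property of Borel sets of types *)

Section BorelDecided.
Context (L : language) (D : Type) (N : structure L D) (V : Type) (M : set D)
  (X Y : set (V -> D)) (P : set (set (V -> D))).
Hypotheses (cL : countable_language L) (cV : countable [set: V])
  (cM : countable M) (cP : countable P)
  (Pdec : forall S R, P S -> P R ->
     exists2 S', P S' & S' `<=` S /\ (S' `<=` R \/ S' `&` R = set0))
  (dM : forall S, definable N M S -> decided X P S)
  (mY : meager X P (~` Y)).

Definition type_preimage (S : set (type_space_of N M Y)) : set (V -> D) :=
  [set x | Y x /\ exists2 p, S p & set_val p = tp N M x].

Let decided_off (A B : set (V -> D)) :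
  (forall x, Y x -> A x <-> B x) -> decided X P A -> decided X P B.
Proof.
move=> AB; apply: decided_ext_meager => //; apply: meager_sub mY => x _ nAB Yx.
by apply: nAB; exact: AB.
Qed.

Let decided0 : decided X P set0.
Proof. by apply: dM; exact: definable0. Qed.

(** There are only countably many formulas over [M], so the preimage of an open set is, within [Y],
    a countable union of [M]-definable sets. *)
Lemma borel_decided (S : set (type_space_of N M Y)) :
  borel S -> decided X P (type_preimage S).
Proof.
have point (x : V -> D) : Y x ->
    exists p : type_space_of N M Y, set_val p = tp N M x.
  by move=> Yx; exists (SigSub (mem_set (imageP (tp N M) Yx))).
apply: (smallest_sub (X := [set S | decided X P (type_preimage S)])).
  split => /=.
  - by apply: decided_off decided0 => x Yx; split=> [//|[_ []]].
  - move=> A dA; apply: decided_off (decidedC dA) => x Yx; split.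
      move=> nA; split=> //; have [p px] := point x Yx.
      by exists p => //; split=> // Ap; apply: nA; split=> //; exists p.
    move=> [_ [p [_ nAp] px]] [_ [q Aq qx]]; apply: nAp.
    by rewrite (_ : p = q) //; apply: val_inj; rewrite [LHS]px [RHS]qx.
  - move=> A dA; apply: decided_off (decided_bigcup cP Pdec dA) => x Yx; split.
      by move=> [n [_ [p Ap px]]]; split=> //; exists p => //; exists n.
    by move=> [_ [p [n _ Ap] px]]; exists n; split=> //; exists p.
move=> _ [W oW <-] /=.
have [psi [dpsi psiP]] := definable_enumeration N cL cV cM.
pose F i := if pselect (forall y, psi i y -> W (tp N M y)) then psi i else set0.
have dF i : decided X P (F i).
  by rewrite /F; case: pselect => /= ?; [exact: dM|exact: decided0].
apply: decided_off (decided_bigcup cP Pdec dF) => x Yx; split.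
  move=> [i]; rewrite /F; case: pselect => //= H psix; split=> //.
  by have [p px] := point x Yx; exists p => //; rewrite /preimage /= px; exact: H.
move=> [_ [p Op px]]; have Wx : W (tp N M x) by rewrite -px.
have [S' [dS' S'x S'O]] := open_stone oW Wx.
have [i iS] := psiP _ dS'; exists i; rewrite /F iS.
by case: pselect.
Qed.

End BorelDecided.

Theorem theorem3p19
  (L : language) (T : set (sentence L))
  (HL : countable_language L) (HT : complete_theory T)
  (kappa : Type) (D : Type) (N : structure L D) (HN : monster kappa T N)
  (A : set D) (HA : countable A)
  (alpha : ordinal_type) (Halpha : countable [set: alpha])
  (X : set (alpha -> D)) (HX : type_definable N A X)
  (E : set ((alpha -> D) * (alpha -> D)))
  (HE : invariant_Fsigma_equiv kappa N X E)
  (U : nat -> set ((alpha -> D) * (alpha -> D))) (HU : normal_form N X E U)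
  (Hbounded : bounded_equiv kappa X E)
  (C : set (alpha -> D)) (HC : quotient_set X E C)
  (HCclosed : ~ strongly_closed_on U E C)
  (G : set (D -> D)) (HG : aut_subgroup N G)
  (Y : set (alpha -> D)) (HCY : C `<=` Y) (HYX : Y `<=` X)
  (HYGdelta : pseudo_Gdelta kappa N Y)
  (HYE : union_of_classes X E Y) (HYG : set_invariant G Y)
  (HGC : transitive_on G C)
  (HGU : forall s, G s -> exists n, forall c, C c -> U n (c, s \o c)) :
  ~ smooth_on N A E Y.

Proof.
move=> [M [cM AM M_el [f f_borel fE]]].
have [kbig [D_inh _] Nsat Nhom] := HN.
have [E_inv _ E_eq] := HE; have [Erefl Esym Etrans] := E_eq.
have [tU EU U0 Usym Ucomp] := HU.
have [Tn HTh] := thickening_exists HL Halpha tU Usym.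
have [dT Tdec Tsym TU] := HTh.
have [a0 Xa0 C_a0] := HC.
have Ca0 : C a0 by rewrite -C_a0; split=> //; exact: Erefl.
have CX : C `<=` X by rewrite -C_a0 => x [].
have UE n x y : U n (x, y) -> E (x, y) by rewrite EU; exists n.
have CE x y : C x -> X y -> E (x, y) -> C y.
  rewrite -C_a0 => -[Xx Ex] Xy Exy; split=> //; exact: Etrans Exy.
have CC x y : C x -> C y -> E (x, y).
  move=> Cx Cy; have := Cx; have := Cy; rewrite -C_a0 => -[Xy Ey] [Xx Ex].
  by apply: (Etrans x a0 y) => //; exact: Esym.
have EM_type := equiv_of_type kbig Nsat Nhom D_inh Halpha cM AM M_el HX E_inv
  E_eq Hbounded.
have [G_aut G_id G_comp G_inv] := HG.
pose Gm : set ((alpha -> D) -> (alpha -> D)) :=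
  [set (fun a => s \o a) | s in G].
have Gm_id : Gm id by exists id.
have Gm_comp g h : Gm g -> Gm h -> Gm (g \o h).
  by move=> [s Gs <-] [t Gt <-]; exists (s \o t) => //; exact: G_comp.
have Gm_C g x : Gm g -> C x -> C (g x).
  move=> [s Gs <-] Cx; have [n /(_ x Cx) /UE Exs] := HGU s Gs.
  by apply: CE Exs => //; apply: HYX; apply: (HYG s Gs x).1; exact: HCY.
have Gm_inv g : Gm g -> exists2 h, Gm h & cancel g h /\ cancel h g.
  move=> [s Gs <-]; have [t Gt [st ts]] := G_inv s Gs.
  exists (fun a => t \o a); first by exists t.
  by split=> a; apply: funext => v /=; rewrite ?st ?ts.
have Gm_trans x y : C x -> C y -> exists2 g, Gm g & g x = y.
  move=> Cx Cy; have [s Gs sxy] := HGC x y Cx Cy.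
  by exists (fun a => s \o a) => //; exists s.
have TG n k g x y : Gm g -> Tn n k (g x) (g y) <-> Tn n k x y.
  by move=> [s Gs <-]; apply: (thickening_automorphism HTh); exact: G_aut.
have Trefl n k x : C x -> Tn n k x x.
  by move=> Cx; apply: (thickening_refl HU HTh); exact: CX.
have Tthin n j : exists k, forall x y z, C x -> C y -> C z ->
    Tn n k x y -> Tn n k y z -> Tn n.+1 j x z.
  have [k kP] := thickening_comp kbig Nsat Halpha HA HX HU HTh n j.
  by exists k => x y z Cx Cy Cz; apply: kP; exact: CX.
have Tdisp g : Gm g -> exists n, forall k x, C x -> Tn n k x (g x).
  move=> [s Gs <-]; have [n nP] := HGU s Gs.
  by exists n => k x Cx; move: k; apply/TU; exact: nP.
have Cne : C !=set0 by exists a0.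
have Ttb (ks : nat -> nat) :=
  totally_bounded kbig Nsat Halpha HX HU HTh HL cM AM CX EM_type ks Cne.
(* If all pairs in [C] satisfied every [Tn n k], then [U n] and [E] would agree on [C], against the
   failure of strong closedness. *)
have Tunb n : exists k x y, [/\ C x, C y & ~ Tn n k x y].
  apply: contrapT => H; apply: HCclosed; exists n.
  apply/seteqP; split=> -[x y] [/= Rxy [Cx Cy]]; split=> //=; last exact: UE Rxy.
  apply/TU => k; apply: contrapT => nT; apply: H.
  by exists k, x, y.
have [J [Jideal JC Jcover]] :=
  maximal_invariant_ideal Gm_id Gm_comp Gm_C Cne.
have [Jsub _ Jtr JnC] := Jideal.
have [W W_open YW] := HYGdelta.
(* No single countable parameter set would do at this stage: balls bring in their centres, and
   translations move the parameters. *)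
pose Q S := (exists2 B, countable B & definable N B S) /\ ~ J S.
have cU (B B' : set D) : countable B -> countable B' -> countable (B `|` B').
  by move=> ? ?; rewrite -bigcup2inE; apply: bigcup_countable => // -[|[|]].
have defI (S S' : set (alpha -> D)) :
    (exists2 B, countable B & definable N B S) ->
    (exists2 B, countable B & definable N B S') ->
    exists2 B, countable B & definable N B (S `&` S').
  move=> [B cB dS] [B' cB' dS']; exists (B `|` B'); first exact: cU.
  by apply: definableI; [apply: definable_sub dS|apply: definable_sub dS'] => y;
    [left|right].
have defC (S : set (alpha -> D)) :
    (exists2 B, countable B & definable N B S) ->
    exists2 B, countable B & definable N B (~` S).
  by move=> [B cB dS]; exists B => //; exact: definableC.
have c_range (a : alpha -> D) : countable (range a).
  exact: sub_countable (card_image_le _ _) Halpha.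
have dball n k a : definable N (set0 `|` range a) [set x | Tn n k a x].
  exact: (definable_fix_left a (dT n k)).
have defball n k a : exists2 B, countable B & definable N B [set x | Tn n k a x].
  by exists (set0 `|` range a) => //; apply: cU.
have Qtr g S : Gm g -> Q S -> Q [set x | S (g x)].
  move=> Gg [[B cB dS] nJS]; split.
    have [s Gs gs] := Gg; have [t Gt [st ts]] := G_inv s Gs.
    exists (t @` B); first exact: sub_countable (card_image_le _ _) cB.
    by rewrite -gs; apply: definable_automorphism dS => //; exact: G_aut.
  have [h Gh [gh hg]] := Gm_inv g Gg; move=> /(Jtr h _ Gh) JS; apply: nJS.
  by apply: Jsub JS _ => x /=; rewrite hg.
have [psi [dpsi psiP]] := definable_enumeration N HL Halpha cM.
have QT : Q setT.
  split; first by exists set0 => //; exact: definableT.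
  by move=> JT; apply: JnC; exact: Jsub JT _.
have Qdich S R : Q S -> (exists2 B, countable B & definable N B R) ->
    exists2 S', Q S' & S' `<=` S /\ (S' `<=` R \/ S' `&` R = set0).
  move=> [dS nJS] dR; have [nJ|nJ] := positive_dichotomy Jideal R nJS.
    by exists (S `&` R); [split=> //; exact: defI|split=> [x []|] //; left => x []].
  exists (S `\` R); first by split=> //; apply: defI => //; exact: defC.
  split=> [x []|] //; right; apply/seteqP; split=> x // [[_ nR] Rx].
  exact: nR.
have Qopen j S : Q S -> exists2 S', Q S' & S' `<=` S /\ X `&` S' `<=` W j.
  move=> [dS nJS].
  have [a n Ca|ks [n [a [Ca nJB BW]]]] := positive_in_open Gm_C Jideal JC
      Jcover Gm_trans Tdec TG Ttb (X := X) (V := W j) nJS Cne.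
    (* A point of [X] that is [U n]-related to [a] is again in the class [C], hence in [Y] and in
       [W j]. *)
    apply: (ball_in_pseudo_open kbig Nsat Halpha HA HX HTh (W_open j)).
    move=> x Xx /UE Eax; have : Y x by apply: HCY; exact: CE Eax.
    by rewrite YW => /(_ j I).
  exists (S `&` thick_ball Tn ks n a); last first.
    by split=> [x []|x [Xx [_ Bx]]] //; apply: BW.
  split=> //; apply: defI => //; exists (set0 `|` range a); first exact: cU.
  exact: (definable_bigU (F := fun i => [set x | Tn i (ks i) a x]) n
    (fun i => dball i (ks i) a)).
have Qfar S1 S2 n : Q S1 -> Q S2 -> exists S1' S2' k,
    [/\ Q S1', Q S2', S1' `<=` S1, S2' `<=` S2 &
      forall x y, C x -> C y -> S1' x -> S2' y -> ~ Tn n k x y].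
  move=> [d1 nJ1] [d2 nJ2].
  have [n1 [k1 [n2 [k2 [c [Cc nJ1' nJ2' [k far]]]]]]] := positive_far Gm_C
    Jideal JC Jcover Gm_inv Gm_trans Tdec Tsym Trefl TG Tthin Tdisp Ttb Tunb n
    nJ1 nJ2.
  exists (S1 `&` Tn n1 k1 c), (S2 `\` Tn n2 k2 c), k; split.
  - by split=> //; apply: defI => //; exact: defball.
  - by split=> //; apply: defI => //; apply: defC; exact: defball.
  - by move=> x [].
  - by move=> x [].
  - by move=> x y Cx Cy [_ Tx] [_ nTy]; exact: far.
have Qrec S1 S2 : Q S1 -> Q S2 -> exists g h,
    [/\ Gm g, cancel g h /\ cancel h g, Q (S1 `&` [set x | S2 (g x)]) &
      forall R, Q R -> Q [set x | R (g x)] /\ Q [set x | R (h x)]].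
  move=> Q1 Q2; have [g Gg nJg] := positive_recurrence Jideal JC Jcover Q1.2 Q2.2.
  have [h Gh ghK] := Gm_inv g Gg; exists g, h; split=> //.
    by split=> //; apply: defI; [exact: Q1.1|exact: (Qtr g S2 Gg Q2).1].
  by move=> R QR; split; exact: Qtr.
have QdefP S : Q S -> exists2 B, countable B & definable N B S by case.
have Qdec S R : Q S -> Q R \/ (exists i, R = psi i) ->
    exists2 S', Q S' & S' `<=` S /\ (S' `<=` R \/ S' `&` R = set0).
  move=> QS [/QdefP dR|[i ->]]; first exact: Qdich.
  by apply: Qdich => //; exists M.
have [P [PT [PQ [cP [Popen Pdec Pfar Prec]]]]] :=
  countable_subfamily QT Qopen Qdec Qfar Qrec.
have mY : meager X P (~` Y).
  apply: (@meager_sub _ _ _ _ [set x | exists j, ~ W j x]).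
    move=> x _ nYx; apply: contrapT => H; apply: nYx; rewrite YW => j _.
    by apply: contrapT => nW; apply: H; exists j.
  apply: meager_bigcup => j; apply: meager_nowhere_dense => S PS.
  have [S' PS' [SS SW]] := Popen j S PS; exists S' => //; split=> // x Xx Sx.
  by apply; apply: SW.
have decM S : definable N M S -> decided X P S.
  move=> /psiP [i <-]; apply: decided_basic => R PR.
  by apply: Pdec => //; right; exists i.
have PdecP S R : P S -> P R ->
    exists2 S', P S' & S' `<=` S /\ (S' `<=` R \/ S' `&` R = set0).
  by move=> PS PR; apply: Pdec => //; left.
pose bit i := type_preimage (f @^-1` [set z : cantor_space | z i = true]).
have dbit i : decided X P (bit i).
  apply: borel_decided HL Halpha cM cP PdecP decM mY _ _.
  apply: f_borel; apply: sub_gen_smallest.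
  exact: (open_cantor_bit i true).
have bit_inv i x y m : X x -> X y -> bit i x -> Y y -> (forall k, Tn m k x y) ->
    bit i y.
  move=> Xx Xy [Yx [p fp px]] Yy /TU /UE Exy; split=> //.
  exists (SigSub (mem_set (imageP (tp N M) Yy))) => //.
  rewrite /preimage /= -(fE p _).1 //.
  by exists x, y.
have PC S : P S -> exists2 x, C x & S x.
  move=> /PQ [_ nJS]; apply: contrapT => H; apply: nJS; apply: Jsub JC _ => x Sx Cx.
  by apply: H; exists x.
have Plim_near (S S' : nat -> set (alpha -> D)) m :
    (forall n, P (S n)) -> (forall n, P (S' n)) ->
    (forall n, S n.+1 `<=` S n) -> (forall n, S' n.+1 `<=` S' n) ->
    (forall n k, exists x y, [/\ C x, C y, S n x, S' n y & Tn m k x y]) ->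
    exists x y, [/\ X x, X y, forall n, S n x, forall n, S' n y &
      forall k, Tn m k x y].
  move=> PS PS' Sdec S'dec.
  apply: (limit_near kbig Nsat Halpha HA HX HTh CX) => // n.
    exact: QdefP (PQ _ (PS n)).
  exact: QdefP (PQ _ (PS' n)).
have Plim_far (S S' : nat -> set (alpha -> D)) (ks : nat -> nat) :
    (forall n, P (S n)) -> (forall n, P (S' n)) ->
    (forall n, S n.+1 `<=` S n) -> (forall n, S' n.+1 `<=` S' n) ->
    (forall n, exists x y, [/\ C x, C y, S n x, S' n y &
       forall i, (i < n)%N -> ~ Tn i (ks i) x y]) ->
    exists x y, [/\ X x, X y, forall n, S n x, forall n, S' n y &
      forall i, ~ Tn i (ks i) x y].
  move=> PS PS' Sdec S'dec.
  apply: (limit_far kbig Nsat Halpha HA HX HTh CX) => // n.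
    exact: QdefP (PQ _ (PS n)).
  exact: QdefP (PQ _ (PS' n)).
have [x [y [[Xx Yx] [Xy Yy] bits far]]] := generic_pair_undistinguished cP Gm_C
  Tdisp PC Pfar Prec Plim_near Plim_far PT mY (fun i x => @proj1 _ _) dbit bit_inv.
pose px : type_space_of N M Y := SigSub (mem_set (imageP (tp N M) Yx)).
pose py : type_space_of N M Y := SigSub (mem_set (imageP (tp N M) Yy)).
have bitP i z (Yz : Y z) (pz : type_space_of N M Y) : set_val pz = tp N M z ->
    bit i z <-> f pz i = true.
  move=> pzE; split=> [[_ [q fq qz]]|fz]; last by split=> //; exists pz.
  by rewrite (_ : pz = q) //; apply: val_inj; rewrite [LHS]pzE [RHS]qz.
have fxy : f px = f py.
  apply: funext => i; apply/idP/idP.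
    by move=> /(bitP i x Yx px erefl) /bits /(bitP i y Yy py erefl).
  by move=> /(bitP i y Yy py erefl) /bits /(bitP i x Yx px erefl).
have same_type (a b : alpha -> D) : tp N M a = tp N M b ->
    forall S, definable N M S -> S a -> S b.
  move=> ab S [phi ->] Sa; have : tp_set N (B := M) a phi by [].
  by have -> : tp_set N (B := M) a = tp_set N b by have := congr1 val ab.
have X_type a b : tp N M a = tp N M b -> X a -> X b.
  move=> ab Xa; have /type_definableP := HX; apply => S dS XS.
  by apply: (same_type a b ab S); [exact: definable_sub dS|exact: XS].
(* The reduction only provides equivalent realizations [a] and [b] of the two types. Since points of
   [X] with the same type over [M] are equivalent, [x] and [y] are equivalent too, although they are
   far apart at every radius. *)
have [a [b [ax by_ Eab]]] := (fE px py).2 fxy.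
have Xa : X a by apply: X_type Xx; rewrite ax.
have Xb : X b by apply: X_type Xy; rewrite by_.
have Exy : E (x, y).
  apply: (Etrans x a y) => //.
    by apply: EM_type => //; apply: (same_type x a); rewrite ax.
  by apply: (Etrans a b y) => //; apply: EM_type => //; apply: (same_type b y).
move: Exy; rewrite EU => -[n _ /TU Txy]; have [k nT] := far n.
exact: nT (Txy k).
Qed.
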